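(* Let $\mathcal{B}(\boldsymbol{d},\boldsymbol{k})$ be the set of all bipartite graphs with a given node bipartition, degrees $\boldsymbol{d}=(d_1,\dots,d_n)$ on the left and $\boldsymbol{k}=(k_1,\dots,k_m)$ on the right, where $M=\sum_i d_i=\sum_j k_j$. Suppose all degrees are at least $1$ and that $3\leq d_{\max},k_{\max}\leq\frac13\sqrt{M}$, where $d_{\max}=\max_i d_i$, $k_{\max}=\max_j k_j$, and let $\Delta=\max\{d_{\max},k_{\max}\}$. Then the mixing time of the bipartite switch chain on $\mathcal{B}(\boldsymbol{d},\boldsymbol{k})$ satisfies \[\tau(\varepsilon)\leq\Delta^{10}M^7\big(\tfrac12 M\log(M)+\log(\varepsilon^{-1})\big).\]
   Context: $\mathcal{B}(\boldsymbol{d},\boldsymbol{k})$ consists of simple bipartite graphs with fixed bipartition $X=\{x_1,\dots,x_n\}$, $Y=\{y_1,\dots,y_m\}$, $\deg(x_i)=d_i$, $\deg(y_j)=k_j$. The bipartite switch chain: from the current graph $B$, with probability $1/2$ do nothing; otherwise choose two distinct edges $\{x_1,y_1\},\{x_2,y_2\}$ of $B$ ($x_i\in X$, $y_i\in Y$) uniformly at random and, if $x_1\neq x_2$, $y_1\neq y_2$ and neither $\{x_1,y_2\}$ nor $\{x_2,y_1\}$ is an edge of $B$, replace them by $\{x_1,y_2\},\{x_2,y_1\}$ (otherwise stay). Its stationary distribution $\pi$ is uniform. The mixing time is $\tau(\varepsilon)=\max_{B_0}\min\{T: d_{TV}(P^t(B_0,\cdot),\pi)\leq\varepsilon\text{ for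 all }t\geq T\}$, with $d_{TV}$ total variation distance. *)

(* Defs.v *)
From HB Require Import structures.
From mathcomp Require Import all_boot all_order all_algebra.
From mathcomp Require Import reals exp.
Set Implicit Arguments. Unset Strict Implicit. Unset Printing Implicit Defensive.
Import Order.TTheory GRing.Theory Num.Theory.
Local Open Scope ring_scope.

(* A bipartite graph on X = 'I_n (left, x_i) and Y = 'I_m (right, y_j),
   represented by its edge set: e = (i, j) is the edge {x_i, y_j}. *)
Notation bgraph n m := {set 'I_n * 'I_m}.

Definition degX n m (B : bgraph n m) (i : 'I_n) : nat := #|[set e in B | e.1 == i]|.
Definition degY n m (B : bgraph n m) (j : 'I_m) : nat := #|[set e in B | e.2 == j]|.

Definition in_Bdk n m (d : 'I_n -> nat) (k : 'I_m -> nat) (B : bgraph n m) : bool :=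
  [forall i, degX B i == d i] && [forall j, degY B j == k j].

Definition Bdk n m (d : 'I_n -> nat) (k : 'I_m -> nat) : {set bgraph n m} :=
  [set B | in_Bdk d k B].

Definition switch_ok n m (B : bgraph n m) (e1 e2 : 'I_n * 'I_m) : bool :=
  [&& e1.1 != e2.1, e1.2 != e2.2, (e1.1, e2.2) \notin B & (e2.1, e1.2) \notin B].

Definition switch n m (B : bgraph n m) (e1 e2 : 'I_n * 'I_m) : bgraph n m :=
  if switch_ok B e1 e2 then (B :\ e1 :\ e2) :|: [set (e1.1, e2.2); (e2.1, e1.2)]
  else B.

(* One-step transition probability of the bipartite switch chain:
   with prob 1/2 do nothing; otherwise pick an ordered pair of distinct
   edges uniformly among the |B|(|B|-1) such pairs (equivalently an
   unordered pair uniformly, since the switch is symmetric) and switch. *)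
Definition switchP (R : realType) n m (B B' : bgraph n m) : R :=
  (B == B')%:R / 2 +
  (#|[set p : ('I_n * 'I_m) * ('I_n * 'I_m) |
       (p.1 \in B) && (p.2 \in B) && (p.1 != p.2) && (switch B p.1 p.2 == B')]|)%:R
    / (2 * (#|B| * (#|B| - 1))%:R).

Fixpoint switchPt (R : realType) n m (t : nat) (B0 B : bgraph n m) : R :=
  match t with
  | 0 => (B0 == B)%:R
  | t'.+1 => \sum_(C : bgraph n m) switchPt R t' B0 C * switchP R C B
  end.

Definition unifBdk (R : realType) n m (d : 'I_n -> nat) (k : 'I_m -> nat)
  (B : bgraph n m) : R :=
  if in_Bdk d k B then (#|Bdk d k|%:R)^-1 else 0.

Definition dTV (R : realType) n m (d : 'I_n -> nat) (k : 'I_m -> nat)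
  (t : nat) (B0 : bgraph n m) : R :=
  2^-1 * \sum_(B : bgraph n m) `|switchPt R t B0 B - unifBdk R d k B|.

(* tau(eps) <= b, where tau(eps) = max_{B0} min {T : forall t >= T, dTV <= eps}:
   for every start B0 in B(d,k) some admissible T with T <= b exists
   (this is exactly "the min is <= b" for each B0, i.e. "the max is <= b"). *)
Definition mixing_time_le (R : realType) n m (d : 'I_n -> nat) (k : 'I_m -> nat)
  (eps b : R) : Prop :=
  forall B0 : bgraph n m, B0 \in Bdk d k ->
    exists T : nat, T%:R <= b /\
      forall t : nat, (T <= t)%N -> dTV R d k t B0 <= eps.

(* Main.v *)
Require Import Defs.
From HB Require Import structures.
From mathcomp Require Import all_boot all_order all_algebra.
From mathcomp Require Import reals sequences exp.
From mathcomp Require Import ring lra zify.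
Set Implicit Arguments. Unset Strict Implicit. Unset Printing Implicit Defensive.
Import Order.TTheory GRing.Theory Num.Theory.

(** The switch chain satisfies a Poincare inequality, obtained from a multicommodity flow
    and the helper edges that sparsity provides.

    Flow. Let A, B be two members of Bdk. Choose uniformly an involution al that pairs, at
    every row, the edges of A \ B with those of B \ A, and likewise be at every column. The
    orbits of the group generated by al and be are closed alternating trails, and A becomes
    B by flipping them one after the other. The intermediate pair (A + F, B + F), F being the
    union of the flipped orbits, together with (al, be) determines (A, B), so the flow is
    uniform at these points. A single trail e_0, e_1, ... is flipped by removing e_0 and
    sliding the hole along the trail; the current graph D lacks one edge at a fixed row and
    one at a moving column, and L = A + B - D has one edge too many at both places. The data
    (D, L, e_0, e_i, al, be) determine everything, and summing over al and be exactly cancels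
    the normalisation of the uniform choice. So the flow through D is at most (Delta + 1)^2
    times the number of possible L, and a switch argument bounds that number by M^2 |Bdk|.

    Helpers. A graph D lacking an edge at row x and column y is represented by the member
    D - uv + xv + uy of Bdk, where uv is an edge far from x and y. Moving the hole by one
    step is realised by five switches through a common helper edge; since 9 Delta^2 <= M,
    enough far edges exist. Each switch is used by O(M^2) hole moves.

    The resulting relaxation time is O(Delta^2 M^7), and the remaining factor Delta^8 absorbs
    all constants, the crude bound |Bdk| <= M^(2M) and the rounding of the mixing time. *)

(** * Sums *)

Section Sums.
Local Open Scope ring_scope.

(** All charging arguments below pass through this comparison: an injective encoding [h] sends each
    term to a nonnegative term at least as large. *)
Lemma ler_sum_inj (R : numDomainType) (I J : finType) (P : pred I) (Q : pred J)
    (h : I -> J) (F : I -> R) (G : J -> R) :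
  {in P &, injective h} -> (forall i, P i -> Q (h i)) ->
  (forall j, Q j -> 0 <= G j) -> (forall i, P i -> F i <= G (h i)) ->
  \sum_(i | P i) F i <= \sum_(j | Q j) G j.
Proof.
move=> hI hQ G0 FG; apply: (le_trans (ler_sum _ FG)).
rewrite -(@big_imset _ _ _ _ _ h P G hI) /=.
rewrite [leRHS](bigID [in h @: P]) /= [leLHS](eq_bigl (fun j => Q j && (j \in h @: P))).
  by rewrite lerDl sumr_ge0 // => j /andP[/G0].
by move=> j /=; case: imsetP => [[i Pi ->]|]; rewrite ?andbT ?andbF // hQ.
Qed.

Lemma ler_sum_sub (R : numDomainType) (I : finType) (P Q : pred I) (F : I -> R) :
  (forall i, P i -> Q i) -> (forall i, Q i -> 0 <= F i) ->
  \sum_(i | P i) F i <= \sum_(i | Q i) F i.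
Proof. by move=> PQ F0; apply: (@ler_sum_inj _ _ _ P Q id). Qed.

Lemma ler_sum1 (R : numDomainType) (I : finType) (Q : pred I) (F : I -> R) i :
  Q i -> (forall i, Q i -> 0 <= F i) -> F i <= \sum_(i | Q i) F i.
Proof.
move=> Qi F0; have /= := @ler_sum_sub R I (pred1 i) Q F _ F0.
by rewrite big_pred1_eq; apply=> j /eqP->.
Qed.

(** Weighted Cauchy-Schwarz: the difference of the two sides is half the sum over all i, j of w_i
    w_j (a_i / w_i - a_j / w_j)^2. Since division by 0 gives 0, [a] has to vanish wherever [w]
    does. *)
Lemma sqr_sum_weighted (R : realFieldType) (I : finType) (w a : I -> R) :
  (forall i, 0 <= w i) -> (forall i, w i = 0 -> a i = 0) ->
  (\sum_i a i) ^+ 2 <= (\sum_i w i) * \sum_i a i ^+ 2 / w i.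
Proof.
move=> w0 wa.
have termwise i j : 2 * (a i * a j) <= w i * (a j ^+ 2 / w j) + w j * (a i ^+ 2 / w i).
  have [wi|wi] := eqVneq (w i) 0; first by rewrite (wa _ wi) wi; lra.
  have [wj|wj] := eqVneq (w j) 0; first by rewrite (wa _ wj) wj; lra.
  have -> : a i * a j = w i * w j * (a i / w i) * (a j / w j) by field; rewrite ?wi ?wj.
  have -> : w i * (a j ^+ 2 / w j) = w i * w j * (a j / w j) ^+ 2 by field.
  have -> : w j * (a i ^+ 2 / w i) = w i * w j * (a i / w i) ^+ 2 by field.
  rewrite -subr_ge0.
  set x := a i / w i; set y := a j / w j.
  rewrite (_ : _ - _ = w i * w j * (x - y) ^+ 2); last by ring.
  by apply: mulr_ge0; [apply: mulr_ge0|apply: sqr_ge0].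
have e1 : (\sum_i a i) ^+ 2 = \sum_i \sum_j a i * a j.
  by rewrite expr2 big_distrl; apply: eq_bigr => i _; rewrite big_distrr.
have e2 : (\sum_i w i) * (\sum_i a i ^+ 2 / w i) = \sum_i \sum_j w i * (a j ^+ 2 / w j).
  by rewrite big_distrl; apply: eq_bigr => i _; rewrite big_distrr.
have e3 : \sum_i \sum_j w j * (a i ^+ 2 / w i) = \sum_i \sum_j w i * (a j ^+ 2 / w j).
  by rewrite exchange_big.
suff : 2 * (\sum_i a i) ^+ 2 <= 2 * ((\sum_i w i) * \sum_i a i ^+ 2 / w i) by lra.
rewrite e1 e2 [leRHS]mulrDl mul1r -[X in _ <= _ + X]e3 -big_split mulr_sumr /=.
rewrite ler_sum // => i _.
by rewrite -big_split mulr_sumr /= ler_sum // => j _.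
Qed.

Lemma sqr_sum_le (R : realFieldType) (I : finType) (a : I -> R) :
  (\sum_i a i) ^+ 2 <= #|I|%:R * \sum_i a i ^+ 2.
Proof.
apply: (le_trans (@sqr_sum_weighted _ _ (fun=> 1) a _ _)) => //.
- by move=> i /eqP; rewrite oner_eq0.
- by rewrite sumr_const (eq_bigr (fun i => a i ^+ 2)) // => i _; rewrite divr1.
Qed.

End Sums.

(** * Pairings of a symmetric difference *)

Definition symd (T : finType) (A B : {set T}) : {set T} :=
  [set e | (e \in A) (+) (e \in B)].

Lemma in_symd (T : finType) (A B : {set T}) e :
  (e \in symd A B) = (e \in A) (+) (e \in B).
Proof. by rewrite inE. Qed.

Lemma symdK (T : finType) (F A : {set T}) : symd (symd A F) F = A.
Proof. by apply/setP=> e; rewrite !in_symd addbK. Qed.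

Lemma symdC (T : finType) (A B : {set T}) : symd A B = symd B A.
Proof. by apply/setP=> e; rewrite !in_symd addbC. Qed.

Lemma symdA (T : finType) (A B C : {set T}) : symd A (symd B C) = symd (symd A B) C.
Proof. by apply/setP=> e; rewrite !in_symd addbA. Qed.

(** The third clause makes the involution exchange A \ B with B \ A, and the last one makes it the
    identity off the symmetric difference. A pairing is thus a perfect matching of A \ B with B \ A
    inside the classes of [kappa]. *)
HB.lock Definition pairing (T : finType) (K : eqType) (kappa : T -> K)
    (A B : {set T}) (a : {ffun T -> T}) : bool :=
  [forall e, [&& a (a e) == e, kappa (a e) == kappa e,
    (a e \in A) == (e \in B) & ((e \in A) == (e \in B)) ==> (a e == e)]].

Section Pairing.
Variables (T : finType) (K : eqType) (kappa : T -> K).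
Implicit Types (A B G : {set T}) (a : {ffun T -> T}).

Local Notation pairing := (pairing kappa).

Definition pairings A B : {set {ffun T -> T}} := [set a | pairing A B a].

Lemma pairingP A B a : reflect
  [/\ involutive a, forall e, kappa (a e) = kappa e,
    forall e, (a e \in A) = (e \in B) & forall e, (e \in A) = (e \in B) -> a e = e]
  (pairing A B a).
Proof.
rewrite pairing.unlock; apply: (iffP forallP) => [h|[h1 h2 h3 h4] e].
  split=> e; have /and4P[/eqP h1 /eqP h2 /eqP h3 /implyP h4] := h e => //.
  by move=> eAB; apply/eqP/h4/eqP.
by rewrite h1 h2 h3 !eqxx /=; apply/implyP=> /eqP/h4->.
Qed.

Lemma pairingK A B a : pairing A B a -> involutive a.
Proof. by case/pairingP. Qed.

Lemma pairing_key A B a : pairing A B a -> forall e, kappa (a e) = kappa e.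
Proof. by case/pairingP. Qed.

Lemma pairing_memL A B a : pairing A B a -> forall e, (a e \in A) = (e \in B).
Proof. by case/pairingP. Qed.

Lemma pairing_memR A B a : pairing A B a -> forall e, (a e \in B) = (e \in A).
Proof. by case/pairingP=> aK _ h _ e; rewrite -h aK. Qed.

Lemma pairing_id A B a : pairing A B a -> forall e, (a e == e) = (e \notin symd A B).
Proof.
case/pairingP=> aK _ h h4 e; rewrite in_symd; apply/eqP/idP => [ae|].
  by rewrite -h ae addbb.
by move=> eAB; apply: h4; move: eAB; do 2 case: (e \in _).
Qed.

Lemma pairing_symd A B G a : pairing A B a -> (forall e, (a e \in G) = (e \in G)) ->
  pairing (symd A G) (symd B G) a.
Proof.
case/pairingP=> aK ka h h4 aG; apply/pairingP; split=> // e; first by rewrite !in_symd h aG.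
by rewrite !in_symd => /addIb/h4.
Qed.

(* Conjugation by this involution turns pairings of (A, B) into pairings of
   (symd A G, symd B G). *)
Definition flip_in G a (e : T) : T := if e \in G then a e else e.

Section Flip.
Variables (A B G : {set T}) (a : {ffun T -> T}).
Hypotheses (pa : pairing A B a) (aG : forall e, (a e \in G) = (e \in G))
  (GAB : G \subset symd A B).

Lemma flip_inK : involutive (flip_in G a).
Proof. move=> e; rewrite /flip_in; case eG: (e \in G); last by rewrite eG.
by rewrite aG eG (pairingK pa). Qed.

Lemma flip_in_key e : kappa (flip_in G a e) = kappa e.
Proof. by rewrite /flip_in; case: ifP => // _; apply: (pairing_key pa). Qed.

Lemma flip_in_memL e : (flip_in G a e \in symd A G) = (e \in A).
Proof.
rewrite /flip_in in_symd; case: ifP => eG; last by rewrite eG addbF.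
rewrite aG eG (pairing_memL pa); have := subsetP GAB _ eG; rewrite in_symd.
by do 2 case: (e \in _).
Qed.

Lemma flip_in_memR e : (flip_in G a e \in symd B G) = (e \in B).
Proof.
rewrite /flip_in in_symd; case: ifP => eG; last by rewrite eG addbF.
rewrite aG eG (pairing_memR pa); have := subsetP GAB _ eG; rewrite in_symd.
by do 2 case: (e \in _).
Qed.

(** [flip_in] is a key-preserving bijection from A onto A + G, so flipping an invariant part of the
    symmetric difference keeps all degrees. *)
Lemma card_key_symd k :
  #|[set e in symd A G | kappa e == k]| = #|[set e in A | kappa e == k]|.
Proof.
rewrite -(card_imset _ (inv_inj flip_inK)); apply: eq_card => e.
rewrite !inE; apply/imsetP/andP => [[z]|[eA ek]].
  by rewrite inE => /andP[zA zk] ->; rewrite -flip_in_memL flip_inK flip_in_key.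
by exists (flip_in G a e); rewrite ?flip_inK // inE flip_in_memL flip_in_key eA.
Qed.

Lemma leq_card_pairings_symd : #|pairings A B| <= #|pairings (symd A G) (symd B G)|.
Proof.
pose conj (b : {ffun T -> T}) := [ffun e => flip_in G a (b (flip_in G a e))] : {ffun T -> T}.
have conjI : injective conj.
  move=> b c bc; apply/ffunP=> e.
  have := congr1 (fun g : {ffun T -> T} => g (flip_in G a e)) bc.
  rewrite !ffunE flip_inK.
  exact: (inv_inj flip_inK).
rewrite -(card_imset _ conjI) subset_leq_card //; apply/subsetP=> _ /imsetP[b + ->].
have fL e : (flip_in G a e \in A) = (e \in symd A G) by rewrite -flip_in_memL flip_inK.
have fR e : (flip_in G a e \in B) = (e \in symd B G) by rewrite -flip_in_memR flip_inK.
rewrite !inE => /pairingP[bK bk bAB bid]; apply/pairingP; split=> e; rewrite !ffunE.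
- by rewrite flip_inK bK flip_inK.
- by rewrite flip_in_key bk flip_in_key.
- by rewrite flip_in_memL bAB fR.
by rewrite -fL -fR => /bid->; rewrite flip_inK.
Qed.

End Flip.

(** Flipping G twice returns the original pair, so the inequality applies in both directions. Hence
    the normalisation of the uniform choice of a pairing is the same all along a path. *)
Lemma card_pairings_symd A B G a : pairing A B a ->
  (forall e, (a e \in G) = (e \in G)) -> G \subset symd A B ->
  #|pairings (symd A G) (symd B G)| = #|pairings A B|.
Proof.
move=> pa aG GAB; apply/eqP; rewrite eqn_leq (leq_card_pairings_symd pa) // andbT.
rewrite -{2}[A](symdK G) -{2}[B](symdK G) (@leq_card_pairings_symd _ _ _ a) //.
  exact: pairing_symd.
apply/subsetP=> e /(subsetP GAB); rewrite !in_symd.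
by do 3 case: (e \in _).
Qed.

(** Induction on the size of A \ B: exchange one e in A \ B for an e' in B \ A with the same key,
    pair the rest, and add the transposition of e and e'. *)
Lemma pairings_neq0 A B :
  (forall k, #|[set e in A | kappa e == k]| = #|[set e in B | kappa e == k]|) ->
  exists a, pairing A B a.
Proof.
have [n] := ubnP #|A :\: B|; elim: n A => // n IH A ltn AB.
(* Without such an e', the elements of Y with the key of e would all lie in X; equal cardinalities
   would make the two classes equal and put e into Y. *)
have exch (X Y : {set T}) e : (forall k, #|[set e in X | kappa e == k]| = #|[set e in Y | kappa e == k]|) ->
    e \in X :\: Y -> exists2 e', e' \in Y :\: X & kappa e' = kappa e.
  move=> XY; rewrite inE => /andP[eY eX].
  have [/exists_inP[e' e'YX /eqP ke]|] := boolP [exists e' in Y :\: X, kappa e' == kappa e].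
    by exists e'.
  rewrite negb_exists_in => /forall_inP noe.
  suff /setP/(_ e) : [set z in Y | kappa z == kappa e] = [set z in X | kappa z == kappa e].
    by rewrite !inE eX (negPf eY) eqxx.
  apply/eqP; rewrite eqEcard XY leqnn andbT; apply/subsetP=> z; rewrite !inE => /andP[zY ze].
  rewrite ze andbT; apply: contraLR ze => zX; apply: noe.
  by rewrite inE zX.
have [/eqP|/set0Pn[e eAB]] := eqVneq (A :\: B) set0.
  rewrite setD_eq0 => sAB.
  have eqAB : A = B.
    apply/eqP; rewrite eqEsubset sAB; apply/subsetP=> z zB; apply: contraT => zA.
    have [|e' ] := exch B A z (fun k => esym (AB k)); first by rewrite inE zA zB.
    by rewrite inE => /andP[/negP e'B /(subsetP sAB)].
  by exists [ffun e => e]; apply/pairingP; split=> e; rewrite !ffunE // eqAB.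
have [e' e'BA kee'] := exch A B e AB eAB.
move: (eAB) (e'BA); rewrite !inE => /andP[eB eA] /andP[e'A e'B].
have ne : e != e' by apply: contraNneq eB => ->.
pose A1 := e' |: (A :\ e).
have [|k|a /pairingP[aK ka am aid]] := IH A1.
- move: ltn; rewrite (cardsD1 e (A :\: B)) eAB ltnS; apply: leq_trans.
  rewrite add1n ltnS subset_leq_card //.
  apply/subsetP=> z; rewrite !inE => /andP[zB /orP[/eqP ze|/andP[-> ->]]]; last by rewrite zB.
  by rewrite ze e'B in zB.
- rewrite -AB.
  have [ke|ke] := eqVneq (kappa e) k; last first.
    apply: eq_card => z; rewrite !inE.
    have [->|ze'] := eqVneq z e'; first by rewrite kee' (negPf ke) !andbF.
    by have [->|ze] := eqVneq z e; rewrite //= (negPf ke) andbF.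
  have -> : [set z in A1 | kappa z == k] = e' |: ([set z in A | kappa z == k] :\ e).
    apply/setP=> z; rewrite !inE.
    by have [->|ze'] := eqVneq z e'; rewrite ?kee' ?ke ?eqxx //= andbA.
  rewrite cardsU1 !inE (negPf e'A) andbF /= [in RHS](cardsD1 e) inE eA ke eqxx.
  by [].
have e1 : e \notin A1 by rewrite !inE eqxx /= orbF.
have e'1 : e' \in A1 by rewrite !inE eqxx.
(* Both e and e' are fixed by the smaller pairing, so the transposition does not interfere with
   it. *)
have ae : a e = e by apply: aid; rewrite (negPf e1) (negPf eB).
have ae' : a e' = e' by apply: aid; rewrite e'1 e'B.
have Az z : z != e -> z != e' -> (z \in A1) = (z \in A).
  by move=> ze ze'; rewrite !inE (negPf ze') ze.
have az x z : a x = x -> z != x -> a z != x by move=> ax; apply: contra_neq => azx; rewrite -[z]aK azx.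
exists [ffun z => if z == e then e' else if z == e' then e else a z].
have en := negPf ne; have en' : e' == e = false by rewrite eq_sym.
apply/pairingP; split=> z; rewrite !ffunE.
- have [->|ze] := eqVneq z e; first by rewrite en' eqxx.
  have [->|ze'] := eqVneq z e'; first by rewrite eqxx.
  by rewrite (negPf (az _ _ ae ze)) (negPf (az _ _ ae' ze')) aK.
- have [->//|ze] := eqVneq z e.
  by have [->|ze'] := eqVneq z e'.
- have [->|ze] := eqVneq z e; first by rewrite (negPf e'A) (negPf eB).
  have [->|ze'] := eqVneq z e'; first by rewrite eA e'B.
  by rewrite -Az ?az.
have [->|ze] := eqVneq z e; first by rewrite eA (negPf eB).
have [->|ze'] := eqVneq z e'; first by rewrite e'B (negPf e'A).
by rewrite -Az //; apply: aid.
Qed.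

End Pairing.

(** * Sliding a hole along an alternating trail *)

Definition tog (T : finType) (A : {set T}) (e : T) : {set T} := symd A [set e].

Lemma in_tog (T : finType) (A : {set T}) e z : (z \in tog A e) = (z \in A) (+) (z == e).
Proof. by rewrite in_symd inE. Qed.

Lemma togK (T : finType) e (A : {set T}) : tog (tog A e) e = A.
Proof. exact: symdK. Qed.

Section PairClosure.
Variables (T : finType) (K : eqType) (kappa : T -> K).

Definition pair_closure (a : T -> T) (s : seq T) : {set T} :=
  [set e | (e \in s) || (a e \in s)].

Variables (A B : {set T}) (a : {ffun T -> T}).
Hypothesis pa : pairing kappa A B a.

Lemma pairing_memD e : (a e \in A :\: B) = (e \in B :\: A).
Proof. by rewrite !inE (pairing_memL pa) (pairing_memR pa). Qed.

Lemma pair_closureE s e : (a e \in pair_closure a s) = (e \in pair_closure a s).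
Proof. by rewrite !inE (pairingK pa) orbC. Qed.

Lemma pair_closure_sub s : {subset s <= A :\: B} -> pair_closure a s \subset symd A B.
Proof.
move=> sAB; apply/subsetP=> e; rewrite inE in_symd => /orP[] /sAB; last rewrite pairing_memD.
  by rewrite inE; do 2 case: (e \in _).
by rewrite inE; do 2 case: (e \in _).
Qed.

(** The list stays in A \ B while its images lie in B \ A, so e and a e are distinct and both new:
    adjoining them amounts to toggling them. *)
Lemma pair_closure_rcons s e : {subset rcons s e <= A :\: B} -> e \notin s ->
  pair_closure a (rcons s e) = tog (tog (pair_closure a s) e) (a e).
Proof.
move=> sAB es.
have /sAB eAB : e \in rcons s e by rewrite mem_rcons inE eqxx.
have sAB' z : z \in s -> z \in A :\: B by move=> zs; apply: sAB; rewrite mem_rcons inE zs orbT.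
have aes : a e \notin s.
  by apply/negP => /sAB'; rewrite pairing_memD; move: eAB; rewrite !inE; do 2 case: (e \in _).
have ne : e != a e.
  by rewrite eq_sym (pairing_id pa) in_symd; move: eAB; rewrite !inE; do 2 case: (e \in _).
have aeq z : (a z == e) = (z == a e) by rewrite -(inj_eq (inv_inj (pairingK pa))) (pairingK pa).
apply/setP=> z; rewrite !in_tog !inE !mem_rcons !inE aeq.
have [->|ze] := eqVneq z e; first by rewrite (negPf es) (negPf aes) (negPf ne).
have [->|zae] := eqVneq z (a e); first by rewrite (negPf aes) (pairingK pa) (negPf es).
by rewrite /= !addbF.
Qed.

End PairClosure.

Section Path.
Variables n m : nat.
Notation E := ('I_n * 'I_m)%type.
Implicit Types (A B D : {set E}) (al be : {ffun E -> E}).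

(** Two edges further along the trail: [be] goes from an edge of A \ B to one of B \ A in the same
    column, and [al] back to A \ B in the same row. The iterates of e0 are therefore the edges of
    its trail that lie in A. *)
Definition step al be (e : E) : E := al (be e).

(** The components of this relation are the orbits of the group generated by the two involutions. *)
Definition adj al be : rel E := fun x y => (y == al x) || (y == be x).

Lemma adj_sym al be : involutive al -> involutive be -> connect_sym (adj al be).
Proof.
move=> alK beK; apply: sym_connect_sym => x y; rewrite /adj.
rewrite -[x == al y](inj_eq (inv_inj alK)) alK -[x == be y](inj_eq (inv_inj beK)) beK.
by rewrite [y == _]eq_sym [y == be x]eq_sym.
Qed.

(* The graph reached from A after the hole has moved i steps along the trail of e0: the row
   of e0 and the column of the i-th edge each lack one edge. *)
Definition node al be A e0 i : {set E} :=
  tog (symd A (pair_closure be (traject (step al be) e0 i))) (iter i (step al be) e0).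

Definition dorbit al be e0 : {set E} := pair_closure be (orbit (step al be) e0).

Definition hole al be (e0 : E) i : E := (e0.1, (iter i (step al be) e0).2).

Variables (A B : {set E}) (al be : {ffun E -> E}).
Hypotheses (pal : pairing fst A B al) (pbe : pairing snd A B be).
Notation sg := (step al be).

Lemma step_inj : injective sg.
Proof. exact: inj_comp (inv_inj (pairingK pal)) (inv_inj (pairingK pbe)). Qed.

Lemma step_memD e : (sg e \in A :\: B) = (e \in A :\: B).
Proof. by rewrite !inE !((pairing_memL pal), (pairing_memR pal), (pairing_memL pbe), (pairing_memR pbe)). Qed.

Lemma iter_memD e i : (iter i sg e \in A :\: B) = (e \in A :\: B).
Proof. by elim: i => //= i IH; rewrite step_memD. Qed.

Variable e0 : E.
Hypothesis e0AB : e0 \in A :\: B.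
Notation ell := (order sg e0).

Lemma traject_memD e i : e \in A :\: B -> {subset traject sg e i <= A :\: B}.
Proof. by move=> eAB _ /trajectP[j _ ->]; rewrite iter_memD. Qed.

Lemma iter_notin_traject i : i < ell -> iter i sg e0 \notin traject sg e0 i.
Proof.
move=> il; have := orbit_uniq sg e0; rewrite /orbit.
have -> : ell = i.+1 + (ell - i.+1) by rewrite subnKC.
rewrite trajectD cat_uniq => /andP[+ _]; rewrite trajectSr rcons_uniq.
by case/andP.
Qed.

Lemma iter_notin_traject1 i : i.+1 < ell -> iter i.+1 sg e0 \notin traject sg (sg e0) i.
Proof.
by move=> /iter_notin_traject; apply: contra => h; rewrite trajectS inE h orbT.
Qed.

Lemma e0_notin_traject1 i : i < ell -> e0 \notin traject sg (sg e0) i.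
Proof.
move=> il; have := orbit_uniq sg e0; rewrite /orbit.
have -> : ell = i.+1 + (ell - i.+1) by rewrite subnKC.
by rewrite trajectD cat_uniq => /andP[+ _]; rewrite trajectS => /andP[].
Qed.

Lemma closure_traject i : i < ell ->
  pair_closure be (traject sg e0 i.+1) =
  tog (tog (pair_closure be (traject sg e0 i)) (iter i sg e0)) (be (iter i sg e0)).
Proof.
move=> il; rewrite trajectSr (pair_closure_rcons pbe) //; last exact: iter_notin_traject.
by rewrite -trajectSr; apply: traject_memD.
Qed.

Lemma node0 : node al be A e0 0 = tog A e0.
Proof.
rewrite /node /=; congr tog; apply/setP=> e.
by rewrite in_symd !inE addbF.
Qed.

Lemma nodeS i : i.+1 < ell ->
  node al be A e0 i.+1 = tog (tog (node al be A e0 i) (iter i.+1 sg e0)) (be (iter i sg e0)).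
Proof.
move=> il; rewrite /node closure_traject 1?ltnW //.
apply/setP=> e; rewrite !(in_tog, in_symd).
by do !case: (_ == _); do !case: (_ \in _).
Qed.

Lemma be_iterE i : be (iter i sg e0) = ((iter i.+1 sg e0).1, (iter i sg e0).2).
Proof.
rewrite [LHS]surjective_pairing (pairing_key pbe).
by rewrite [iter i.+1 _ _]iterS (pairing_key pal).
Qed.

Lemma be_iter_last i : i.+1 = ell -> be (iter i sg e0) = hole al be e0 i.
Proof. by move=> il; rewrite be_iterE il iter_order //; apply: step_inj. Qed.

(** At the last edge the hole sits exactly where the closing edge of the trail belongs; adding it
    completes the flip. *)
Lemma node_last i : i.+1 = ell ->
  tog (node al be A e0 i) (hole al be e0 i) = symd A (dorbit al be e0).
Proof.
move=> il; rewrite -be_iter_last // /node /dorbit /orbit -il closure_traject ?il //.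
apply/setP=> e; rewrite !(in_tog, in_symd).
by do !case: (_ == _); do !case: (_ \in _).
Qed.

(** [node] groups the toggled edges by columns: the pairs of e_j and be e_j, and e_i alone. The same
    set grouped by rows consists of the pairs of e_j and al e_j for 1 <= j <= i, and e0 alone. The
    first form gives the column degrees, the second the row degrees. *)
Lemma nodeX i : i < ell ->
  node al be A e0 i = tog (symd A (pair_closure al (traject sg (sg e0) i))) e0.
Proof.
elim: i => [|i IH] il.
  rewrite node0; congr tog; apply/setP=> e.
  by rewrite in_symd !inE addbF.
rewrite nodeS // IH 1?ltnW // trajectSr (pair_closure_rcons pal); first last.
- by rewrite -iterSr iter_notin_traject1.
- by rewrite -trajectSr; apply: traject_memD; rewrite step_memD.
rewrite -iterSr [iter i.+1 _ _]iterS /step (pairingK pal) -/(step al be).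
apply/setP=> e; rewrite !(in_tog, in_symd).
by do !case: (_ == _); do !case: (_ \in _).
Qed.

Lemma dorbit_sub : dorbit al be e0 \subset symd A B.
Proof. by apply: (pair_closure_sub pbe); apply: traject_memD. Qed.

Lemma dorbit_memL e : e \in dorbit al be e0 -> (e \in A) = (e \in orbit sg e0).
Proof.
have oAB := @traject_memD e0 ell e0AB.
rewrite inE => /orP[eo|beo]; first by rewrite eo; move/oAB: eo; rewrite inE => /andP[].
have : e \in B :\: A by rewrite -(pairing_memD pbe); apply: oAB.
rewrite inE => /andP[eA eB]; rewrite (negPf eA); apply/esym/negP => /oAB.
by rewrite inE eB.
Qed.

Lemma node_out i e : i < ell -> e \notin dorbit al be e0 -> (e \in node al be A e0 i) = (e \in A).
Proof.
move=> il; rewrite inE negb_or => /andP[eo beo].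
have sub : {subset traject sg e0 i <= orbit sg e0}.
  move=> _ /trajectP[j ji ->]; apply/trajectP; exists j => //; exact: ltn_trans il.
have ne : e != iter i sg e0.
  by apply: contraNneq eo => ->; apply/trajectP; exists i.
rewrite in_tog in_symd (negPf ne) addbF inE (negPf (contra (sub _) eo)).
by rewrite (negPf (contra (sub _) beo)) addbF.
Qed.

(** Off the orbit nothing has been changed, and on the orbit A consists of the iterates of e0. So A
    can be read off from the node, e0 and the involutions. *)
Lemma node_decode i : i < ell ->
  A = [set e | if e \in dorbit al be e0 then e \in orbit sg e0 else e \in node al be A e0 i].
Proof.
move=> il; apply/setP=> e; rewrite inE.
by case: ifP => [/dorbit_memL|/negbT/node_out->].
Qed.

Lemma card_dorbit : #|dorbit al be e0| = (ell + ell)%N.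
Proof.
have oAB := @traject_memD e0 ell e0AB.
have -> : dorbit al be e0 = [set e in orbit sg e0] :|: [set be e | e in [set e in orbit sg e0]].
  apply/setP=> e; rewrite !inE; congr (_ || _); apply/idP/imsetP => [h|[z]].
    by exists (be e); rewrite ?inE ?(pairingK pbe).
  by rewrite inE => zo ->; rewrite (pairingK pbe).
rewrite cardsU card_imset; last exact: inv_inj (pairingK pbe).
have -> : #|[set e in orbit sg e0]| = ell.
  by rewrite -(size_orbit sg e0) -(card_uniqP (orbit_uniq sg e0)); apply: eq_card => e; rewrite inE.
rewrite (_ : _ :&: _ = set0) ?cards0 ?subn0 //.
apply/setP=> e; rewrite !inE; apply/negP => /andP[/oAB eAB /imsetP[z zo ez]].
move: zo; rewrite inE => /oAB; rewrite -(pairingK pbe z) -ez (pairing_memD pbe).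
by move: eAB; rewrite !inE => /andP[/negPf->]; rewrite andbF.
Qed.

(** For the hard inclusion, the set is closed under both involutions: al z is [be] of the
    predecessor of z when z is an iterate, and the successor of be z when be z is one. *)
Lemma dorbit_connect e :
  (e \in dorbit al be e0) = connect (adj al be) e0 e.
Proof.
set r := adj al be.
have sgI := step_inj.
have alO z : z \in dorbit al be e0 -> al z \in dorbit al be e0.
  rewrite !inE -!fconnect_orbit => /orP[|] zo; apply/orP.
    by right; rewrite (same_fconnect1_r sgI) {2}/step (pairingK pbe) (pairingK pal).
  by left; rewrite -[z in al z](pairingK pbe) -[al _]/(sg _) -(same_fconnect1_r sgI).
have beO z : z \in dorbit al be e0 -> be z \in dorbit al be e0.
  by rewrite (pair_closureE pbe).
have cl : closed r (mem (dorbit al be e0)).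
  apply: intro_closed.
    exact: adj_sym (pairingK pal) (pairingK pbe).
  by move=> x y /orP[/eqP->|/eqP->] h; [apply: alO|apply: beO].
apply/idP/idP => [|h].
  have conn z : z \in orbit sg e0 -> connect r e0 z.
    case/trajectP=> j _ ->; elim: j => [|j IH] /=; first exact: connect0.
    apply: connect_trans IH _; apply: (@connect_trans _ _ (be (iter j sg e0))).
      by apply: connect1; rewrite /r /adj eqxx orbT.
    by apply: connect1; rewrite /r /adj eqxx.
  rewrite inE => /orP[/conn //|/conn h]; apply: connect_trans h _.
  by apply: connect1; rewrite /r /adj (pairingK pbe) eqxx orbT.
rewrite -(closed_connect cl h) inE; apply/orP; left.
by rewrite -fconnect_orbit connect0.
Qed.

End Path.

Lemma card_key_tog_in (T : finType) (K : eqType) (kappa : T -> K) (D : {set T}) e k : e \in D ->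
  (#|[set z in tog D e | kappa z == k]| + (kappa e == k) = #|[set z in D | kappa z == k]|)%N.
Proof.
move=> eD; rewrite [in RHS](cardsD1 e) inE eD /= addnC; congr addn.
apply: eq_card => z; rewrite !(in_tog, inE).
by have [->|ze] := eqVneq z e; rewrite ?eD //= addbF.
Qed.

Lemma card_key_tog_out (T : finType) (K : eqType) (kappa : T -> K) (D : {set T}) e k : e \notin D ->
  (#|[set z in tog D e | kappa z == k]| = #|[set z in D | kappa z == k]| + (kappa e == k))%N.
Proof.
move=> eD; rewrite -(@card_key_tog_in _ _ kappa (tog D e) e) ?togK //.
by rewrite in_tog eqxx addbT.
Qed.

(** * Graphs whose degrees are off by one at a row and a column *)

Section Degrees.
Variables (n m : nat) (d : 'I_n -> nat) (k : 'I_m -> nat).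
Notation E := ('I_n * 'I_m)%type.
Implicit Types (A B D L : {set E}) (q e : E).

Lemma BdkP B : reflect ((forall i, degX B i = d i) /\ (forall j, degY B j = k j)) (B \in Bdk d k).
Proof.
rewrite inE; apply: (iffP andP) => -[h1 h2]; split.
- by move=> i; apply/eqP; move/forallP: h1; apply.
- by move=> i; apply/eqP; move/forallP: h2; apply.
- by apply/forallP=> i; rewrite h1.
- by apply/forallP=> i; rewrite h2.
Qed.

(** The pair [q] merely records the deficient row and the deficient column; it may or may not be an
    edge of D. *)
Definition deficit q : {set {set E}} :=
  [set D | [forall i, degX D i + (q.1 == i) == d i] && [forall j, degY D j + (q.2 == j) == k j]].

Definition excess q : {set {set E}} :=
  [set L | [forall i, degX L i == d i + (q.1 == i)] && [forall j, degY L j == k j + (q.2 == j)]].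

Lemma deficitP q D : reflect
  ((forall i, degX D i + (q.1 == i) = d i)%N /\ (forall j, degY D j + (q.2 == j) = k j)%N)
  (D \in deficit q).
Proof.
rewrite inE; apply: (iffP andP) => -[h1 h2]; split.
- by move=> i; apply/eqP; move/forallP: h1; apply.
- by move=> i; apply/eqP; move/forallP: h2; apply.
- by apply/forallP=> i; rewrite h1.
- by apply/forallP=> i; rewrite h2.
Qed.

Lemma excessP q L : reflect
  ((forall i, degX L i = d i + (q.1 == i))%N /\ (forall j, degY L j = k j + (q.2 == j))%N)
  (L \in excess q).
Proof.
rewrite inE; apply: (iffP andP) => -[h1 h2]; split.
- by move=> i; apply/eqP; move/forallP: h1; apply.
- by move=> i; apply/eqP; move/forallP: h2; apply.
- by apply/forallP=> i; rewrite h1.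
- by apply/forallP=> i; rewrite h2.
Qed.

Lemma card_sum_degX B : #|B| = (\sum_i degX B i)%N.
Proof.
rewrite -sum1_card (partition_big (fun e : E => e.1) xpredT) //=.
by apply: eq_bigr => i _; rewrite sum1_card; apply: eq_card => e; rewrite !inE.
Qed.

End Degrees.

(** * Degrees and pairings along the trail *)

Section PathDegrees.
Variables (n m : nat) (d : 'I_n -> nat) (k : 'I_m -> nat).
Notation E := ('I_n * 'I_m)%type.
Variables (A B : {set E}) (al be : {ffun E -> E}).
Hypotheses (pal : pairing fst A B al) (pbe : pairing snd A B be).
Hypotheses (AO : A \in Bdk d k) (BO : B \in Bdk d k).
Notation sg := (step al be).
Variable e0 : E.
Hypothesis e0AB : e0 \in A :\: B.
Notation ell := (order sg e0).
Notation D i := (node al be A e0 i).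
Notation q i := (hole al be e0 i).
Notation e i := (iter i sg e0).
Notation GX i := (pair_closure al (traject sg (sg e0) i)).
Notation GY i := (pair_closure be (traject sg e0 i)).
(* A + B - node as a multiset of edges; it is again a set. *)
Definition conode i : {set E} := symd (symd A B) (node al be A e0 i).

Lemma iterA i : e i \in A.
Proof. by have := iter_memD pal pbe e0 i; rewrite e0AB inE => /andP[]. Qed.

Lemma iterB i : e i \notin B.
Proof. by have := iter_memD pal pbe e0 i; rewrite e0AB inE => /andP[]. Qed.

Lemma setD_split e' : e' \in A :\: B -> (e' \in A) /\ (e' \notin B).
Proof. by rewrite inE => /andP[]. Qed.

Lemma GXnot i : i < ell -> e0 \notin GX i.
Proof.
move=> il; rewrite inE negb_or (e0_notin_traject1 il) /=.
apply/negP => /(traject_memD pal pbe); rewrite step_memD // => /(_ e0AB).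
rewrite (pairing_memD pal) inE => /andP[/negP]; case.
by have [] := setD_split e0AB.
Qed.

Lemma GYnot i : i < ell -> e i \notin GY i.
Proof.
move=> il; rewrite inE negb_or (iter_notin_traject il) /=.
apply/negP => /(traject_memD pal pbe) => /(_ e0AB).
by rewrite (pairing_memD pbe) inE iterA.
Qed.

Lemma node_togX i : i < ell -> tog (D i) e0 = symd A (GX i).
Proof. by move=> il; rewrite (nodeX pal pbe e0AB il) togK. Qed.

Lemma node_togY i : tog (D i) (e i) = symd A (GY i).
Proof. by rewrite /node togK. Qed.

Lemma conodeX i : i < ell -> conode i = tog (symd B (GX i)) e0.
Proof.
move=> il; rewrite /conode (nodeX pal pbe e0AB il); apply/setP=> z.
by rewrite !(in_tog, in_symd); do !case: (_ == _); do !case: (_ \in _).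
Qed.

Lemma conodeY i : conode i = tog (symd B (GY i)) (e i).
Proof.
rewrite /conode /node; apply/setP=> z.
by rewrite !(in_tog, in_symd); do !case: (_ == _); do !case: (_ \in _).
Qed.

Lemma GX_sub i : GX i \subset symd A B.
Proof. by apply: (pair_closure_sub pal); apply: traject_memD => //; rewrite step_memD. Qed.

Lemma GY_sub i : GY i \subset symd A B.
Proof. by apply: (pair_closure_sub pbe); apply: traject_memD. Qed.

Lemma symdCp (S : {set E}) : S \subset symd A B -> S \subset symd B A.
Proof. by rewrite [symd B A]symdC. Qed.

Lemma pairing_sym (K : eqType) (kappa : E -> K) a : pairing kappa A B a -> pairing kappa B A a.
Proof.
move=> /[dup] /pairingP[aK ak am aid] pa; apply/pairingP; split=> // z.
  exact: pairing_memR pa z.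
by move=> h; apply: aid.
Qed.

Lemma degX_symd i j : degX (symd A (GX i)) j = d j /\ degX (symd B (GX i)) j = d j.
Proof.
split; rewrite /degX.
  rewrite (card_key_symd pal (pair_closureE pal _) (GX_sub i)).
  by have [h _] := BdkP _ _ _ AO; apply: h.
rewrite (card_key_symd (pairing_sym pal) (pair_closureE pal _) (symdCp (GX_sub i))).
by have [h _] := BdkP _ _ _ BO; apply: h.
Qed.

Lemma degY_symd i j : degY (symd A (GY i)) j = k j /\ degY (symd B (GY i)) j = k j.
Proof.
split; rewrite /degY.
  rewrite (card_key_symd pbe (pair_closureE pbe _) (GY_sub i)).
  by have [_ h] := BdkP _ _ _ AO; apply: h.
rewrite (card_key_symd (pairing_sym pbe) (pair_closureE pbe _) (symdCp (GY_sub i))).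
by have [_ h] := BdkP _ _ _ BO; apply: h.
Qed.

Lemma node_deficit i : i < ell -> D i \in deficit d k (q i).
Proof.
move=> il; have [e0A e0B] := setD_split e0AB.
apply/deficitP; split=> j /=.
  rewrite (nodeX pal pbe e0AB il) /degX (card_key_tog_in fst).
    by have [+ _] := degX_symd i j.
  by rewrite in_symd e0A (negPf (GXnot il)).
rewrite /node /degY (card_key_tog_in snd).
  by have [+ _] := degY_symd i j.
by rewrite in_symd iterA (negPf (GYnot il)).
Qed.

Lemma conode_excess i : i < ell -> conode i \in excess d k (q i).
Proof.
move=> il; have [e0A e0B] := setD_split e0AB.
apply/excessP; split=> j /=.
  rewrite (conodeX il) /degX (card_key_tog_out fst).
    by have [_ h] := degX_symd i j; congr addn.
  by rewrite in_symd (negPf e0B) (negPf (GXnot il)).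
rewrite conodeY /degY (card_key_tog_out snd).
  by have [_ h] := degY_symd i j; congr addn.
by rewrite in_symd (negPf (iterB i)) (negPf (GYnot il)).
Qed.

Lemma e0_conode i : i < ell -> e0 \in conode i.
Proof.
move=> il; rewrite conodeX // in_tog eqxx addbT in_symd (negPf (GXnot il)).
by have [_ /negPf->] := setD_split e0AB.
Qed.

Lemma iter_conode i : i < ell -> e i \in conode i.
Proof.
by move=> il; rewrite conodeY in_tog eqxx addbT in_symd (negPf (GYnot il)) (negPf (iterB i)).
Qed.

(** Once e0 is toggled, the node and its complement are A and B flipped on the same union of
    [al]-pairs. The involution is thus a pairing of a pair that can be computed from D, L and e0
    alone. *)
Lemma pairing_nodeX i : i < ell -> pairing fst (tog (D i) e0) (tog (conode i) e0) al.
Proof.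
move=> il; rewrite (node_togX il) (conodeX il) togK.
exact: (pairing_symd pal (pair_closureE pal _)).
Qed.

Lemma pairing_nodeY i : i < ell -> pairing snd (tog (D i) (e i)) (tog (conode i) (e i)) be.
Proof.
move=> il; rewrite node_togY conodeY togK.
exact: (pairing_symd pbe (pair_closureE pbe _)).
Qed.

Lemma card_pairings_nodeX i : i < ell ->
  #|pairings fst (tog (D i) e0) (tog (conode i) e0)| = #|pairings fst A B|.
Proof.
move=> il; rewrite (node_togX il) (conodeX il) togK.
exact: (card_pairings_symd pal (pair_closureE pal _) (GX_sub i)).
Qed.

Lemma card_pairings_nodeY i : i < ell ->
  #|pairings snd (tog (D i) (e i)) (tog (conode i) (e i))| = #|pairings snd A B|.
Proof.
move=> il; rewrite node_togY conodeY togK.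
exact: (card_pairings_symd pbe (pair_closureE pbe _) (GY_sub i)).
Qed.

Lemma iterS_node i : i.+1 < ell -> e i.+1 \in D i.
Proof.
move=> il; rewrite in_tog in_symd iterA.
have := GYnot il; rewrite (closure_traject pal pbe e0AB (ltnW il)) !in_tog.
have -> : (e i.+1 == be (e i)) = false.
  apply/negbTE/negP => /eqP h; have := iterA i.+1.
  by rewrite h (pairing_memL pbe) (negPf (iterB i)).
have -> : (e i.+1 == e i) = false.
  apply/negbTE/negP => /eqP h; have := iter_notin_traject il.
  by rewrite h trajectSr mem_rcons inE eqxx.
by rewrite !addbF => /negPf->.
Qed.

Lemma be_iter_node i : i < ell -> be (e i) \notin D i.
Proof.
move=> il; rewrite in_tog in_symd (pairing_memL pbe) (negPf (iterB i)).
rewrite (pair_closureE pbe) (negPf (GYnot il)) addFb addFb.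
apply/negP => /eqP h; have := iterA i.
by rewrite -h (pairing_memL pbe) (negPf (iterB i)).
Qed.

Lemma iter_eq_node i j : i < ell -> j < ell -> e i = e j -> i = j.
Proof.
move=> il jl ij; have := findex_iter il; rewrite ij findex_iter //.
Qed.

Local Open Scope ring_scope.

(** Cauchy-Schwarz along the path from A through the nodes to the flipped graph. It has ell + 1
    differences, and ell + 1 <= 2 ell, the size of the orbit. *)
Lemma orbit_path (R : realFieldType) (f : {set E} -> R) (g Phi : E -> {set E} -> R) :
  (forall q D, 0 <= Phi q D) ->
  (forall q D, D \in deficit d k q -> q \notin D -> (g q D - f (tog D q)) ^+ 2 <= Phi q D) ->
  (forall q D e, D \in deficit d k q -> e \in D -> (e.1, q.2) \notin D ->
     (g q D - g (q.1, e.2) (tog (tog D e) (e.1, q.2))) ^+ 2 <= Phi q D) ->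
  (f A - f (symd A (dorbit al be e0))) ^+ 2 <=
    #|dorbit al be e0|%:R * (2 * \sum_(i < #|{: E}| | (i < ell)%N) Phi (q i) (D i)).
Proof.
move=> Phi0 H1 H2.
rewrite -(big_ord_widen _ (fun i => Phi (q i) (D i))) ?max_card //.
rewrite (card_dorbit pal pbe e0AB).
have : (0 < ell)%N by apply: order_gt0.
case Eell : ell => [//|l] _.
(* The values along the path, shifted by one: index 0 is A, index j + 1 is the j-th node, and the
   last index ell + 1 is the flipped graph. *)
pose v (i : nat) := if i is j.+1 then if (j <= l)%N then g (q j) (D j)
                    else f (symd A (dorbit al be e0)) else f A.
have v0 : v 0%N = f A by [].
have vS j : (j <= l)%N -> v j.+1 = g (q j) (D j) by rewrite /v => ->.
have vl : v l.+2 = f (symd A (dorbit al be e0)) by rewrite /v ltnn.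
clearbody v.
have lt j : (j <= l)%N -> (j < ell)%N by rewrite Eell.
have -> : f A - f (symd A (dorbit al be e0)) = \sum_(0 <= i < l.+2) (v i - v i.+1).
  rewrite -[RHS]opprK -sumrN (eq_bigr (fun i => v i.+1 - v i)) => [|i _]; last by rewrite opprB.
  by rewrite telescope_sumr // v0 vl opprB.
rewrite big_mkord.
apply: (le_trans (sqr_sum_le _)); rewrite card_ord.
have S0 : 0 <= \sum_(i < l.+1) Phi (q i) (D i) by apply: sumr_ge0.
have e0q : hole al be e0 0 = e0 by rewrite /hole /= -surjective_pairing.
apply: ler_pM => //; first by apply: sumr_ge0 => i _; apply: sqr_ge0.
  by rewrite ler_nat; lia.
(* The first difference is charged to node 0, which it enters; each later one is charged to the node
   it leaves. No node is charged more than twice. *)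
rewrite [leLHS]big_ord_recl [leRHS]mulrDl !mul1r; apply: lerD.
  rewrite [X in _ <= X]big_ord_recl.
  apply: (@le_trans _ _ (Phi (q 0) (D 0))); last by rewrite lerDl sumr_ge0.
  rewrite (vS 0%N isT) v0 -sqrrN opprB.
  have := H1 (q 0%N) (D 0) (node_deficit (lt 0%N isT)).
  rewrite e0q node0 togK; apply.
  by rewrite in_tog eqxx addbT negbK; have [] := setD_split e0AB.
apply: ler_sum => i _.
have il0 : (i <= l)%N by rewrite -ltnS.
rewrite lift0 (vS _ il0).
have il := lt i il0.
have [il'|il'] : i = l :> nat \/ (i < l)%N by lia.
  have ll : i.+1 = ell by rewrite Eell il'.
  have -> : v i.+2 = f (symd A (dorbit al be e0)) by rewrite il' vl.
  rewrite -(node_last pal pbe e0AB ll).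
  apply: H1; first exact: node_deficit.
  by rewrite -(be_iter_last pal pbe ll); apply: be_iter_node.
have il2 : (i.+1 < ell)%N by rewrite Eell.
rewrite (vS _ il') (nodeS pal pbe e0AB il2) (be_iterE pal pbe).
apply: (H2 (q i) (D i) (e i.+1)).
- exact: node_deficit.
- exact: iterS_node.
- by rewrite -(be_iterE pal pbe); apply: be_iter_node.
Qed.

End PathDegrees.

(** * Far edges and switches *)

Definition togs (T : finType) (A : {set T}) (s : seq T) : {set T} := foldl (@tog T) A s.
Arguments togs : simpl never.

Lemma togs_cons (T : finType) (A : {set T}) e s : togs A (e :: s) = togs (tog A e) s.
Proof. by []. Qed.

Lemma togs_rev_inv (T : finType) (s : seq T) : cancel (fun A => togs A s) (fun A => togs A (rev s)).
Proof.
elim: s => // e s IH A; rewrite /togs /= rev_cons -cats1 foldl_cat /=.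
by rewrite -/(togs (tog A e) s) -/(togs _ _) IH togK.
Qed.

Lemma togs_inj (T : finType) (s : seq T) : injective (fun A => togs A s).
Proof. exact: can_inj (togs_rev_inv s). Qed.

Lemma in_togs (T : finType) (A : {set T}) (s : seq T) z : uniq s ->
  (z \in togs A s) = (z \in A) (+) (z \in s).
Proof.
elim: s A => [|e s IH] A /=; first by rewrite addbF.
case/andP=> es us; rewrite togs_cons IH // in_tog inE -addbA.
by congr (_ (+) _); have [->|//] := eqVneq z e; rewrite (negPf es).
Qed.

(** Degree bookkeeping for toggling several edges, in additive form so that no truncated subtraction
    occurs. *)
Lemma card_key_togs (T : finType) (K : eqType) (kappa : T -> K) (D : {set T}) (s : seq T) k :
  uniq s ->
  (#|[set z in togs D s | kappa z == k]| + count (fun e => (e \in D) && (kappa e == k)) s =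
   #|[set z in D | kappa z == k]| + count (fun e => (e \notin D) && (kappa e == k)) s)%N.
Proof.
elim: s D => [|e s IH] D //= /andP[es us].
rewrite togs_cons.
have eq1 : {in s, (fun z => (z \in tog D e) && (kappa z == k)) =1 (fun z => (z \in D) && (kappa z == k))}.
  by move=> z zs /=; rewrite in_tog (negPf (memPn es z zs)) addbF.
have eq2 : {in s, (fun z => (z \notin tog D e) && (kappa z == k)) =1 (fun z => (z \notin D) && (kappa z == k))}.
  by move=> z zs /=; rewrite in_tog (negPf (memPn es z zs)) addbF.
have := IH (tog D e) us; rewrite (eq_in_count eq1) (eq_in_count eq2).
have [eD|eD] := boolP (e \in D) => /=.
  by have := card_key_tog_in kappa k eD; lia.
by have := card_key_tog_out kappa k eD; lia.
Qed.

Lemma degX_togs n m (D : {set 'I_n * 'I_m}) (s : seq ('I_n * 'I_m)) i : uniq s ->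
  (degX (togs D s) i + count (fun e => (e \in D) && (e.1 == i)) s =
   degX D i + count (fun e => (e \notin D) && (e.1 == i)) s)%N.
Proof. exact: card_key_togs. Qed.

Lemma degY_togs n m (D : {set 'I_n * 'I_m}) (s : seq ('I_n * 'I_m)) j : uniq s ->
  (degY (togs D s) j + count (fun e => (e \in D) && (e.2 == j)) s =
   degY D j + count (fun e => (e \notin D) && (e.2 == j)) s)%N.
Proof. exact: card_key_togs. Qed.

Section Far.
Variables (n m : nat).
Notation E := ('I_n * 'I_m)%type.
Variables (G : {set E}) (s : nat).
Hypotheses (GX : forall i, degX G i <= s) (GY : forall j, degY G j <= s).

(** The columns met by row x number at most s, and each of them carries at most s edges. *)
Lemma card_near_row x : #|[set e in G | (x, e.2) \in G]| <= s ^ 2.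
Proof.
rewrite -sum1_card (partition_big (fun e : E => (x, e.2)) [in [set e in G | e.1 == x]]) /=; last first.
  by move=> e; rewrite !inE eqxx andbT => /andP[].
rewrite -mulnn; apply: leq_trans (leq_mul (GX x) (leqnn s)).
rewrite -sum_nat_const; apply: leq_sum => e' _.
apply: leq_trans (GY e'.2); rewrite sum1dep_card subset_leq_card //.
apply/subsetP=> e; rewrite !inE => /andP[/andP[eG _] /eqP <-].
by rewrite eG /=.
Qed.

Lemma card_near_col y : #|[set e in G | (e.1, y) \in G]| <= s ^ 2.
Proof.
rewrite -sum1_card (partition_big (fun e : E => (e.1, y)) [in [set e in G | e.2 == y]]) /=; last first.
  by move=> e; rewrite !inE eqxx andbT => /andP[].
rewrite -mulnn; apply: leq_trans (leq_mul (GY y) (leqnn s)).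
rewrite -sum_nat_const; apply: leq_sum => e' _.
apply: leq_trans (GX e'.1); rewrite sum1dep_card subset_leq_card //.
apply/subsetP=> e; rewrite !inE => /andP[/andP[eG _] /eqP <-].
by rewrite eG /=.
Qed.

(** Union bound: every row or column to be avoided excludes at most s^2 edges. *)
Lemma far_edge (rows : seq 'I_n) (cols : seq 'I_m) :
  (size rows + size cols) * s ^ 2 < #|G| ->
  exists e, [/\ e \in G, {in rows, forall x, (x, e.2) \notin G} &
    {in cols, forall y, (e.1, y) \notin G}].
Proof.
pose far r c := [set e in G | all (fun x => (x, e.2) \notin G) r && all (fun y => (e.1, y) \notin G) c].
suff : #|G| <= #|far rows cols| + (size rows + size cols) * s ^ 2.
  move=> h lt; have : 0 < #|far rows cols| by lia.
  rewrite card_gt0 => /set0Pn[e]; rewrite inE => /and3P[eG /allP h1 /allP h2].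
  by exists e.
elim: rows => [|x r IH].
  elim: cols => [|y c IH].
    rewrite mul0n addn0 subset_leq_card //; apply/subsetP=> e eG.
    by rewrite inE eG.
  apply: (leq_trans IH).
  have : far [::] c \subset far [::] (y :: c) :|: [set e in G | (e.1, y) \in G].
    by apply/subsetP=> e; rewrite !inE /= => /andP[-> ->]; case: (_ \in _).
  move/subset_leq_card/leq_trans/(_ (leq_card_setU _ _)).
  by have := card_near_col y; rewrite /=; nia.
apply: (leq_trans IH).
have : far r cols \subset far (x :: r) cols :|: [set e in G | (x, e.2) \in G].
  by apply/subsetP=> e; rewrite !inE /= => /and3P[-> -> ->]; case: (_ \in _).
move/subset_leq_card/leq_trans/(_ (leq_card_setU _ _)).
by have := card_near_row x; rewrite /=; nia.
Qed.

End Far.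

Section Fill.
Variables (n m : nat) (d : 'I_n -> nat) (k : 'I_m -> nat).
Notation E := ('I_n * 'I_m)%type.

(* [fill q D e] is the member of Bdk that stands for the graph D with a hole at q. *)
Definition is_helper (q : E) (D : {set E}) (e : E) : bool :=
  [&& e \in D, (q.1, e.2) \notin D & (e.1, q.2) \notin D].

Definition fill (q : E) (D : {set E}) (e : E) : {set E} :=
  togs D [:: e; (q.1, e.2); (e.1, q.2)].

Lemma fill_in q D e : D \in deficit d k q -> is_helper q D e -> fill q D e \in Bdk d k.
Proof.
case: q e => x y [u v] /deficitP[DX DY] /and3P[/= uvD xvD uyD].
have us : uniq [:: (u, v); (x, v); (u, y)].
  rewrite /= !inE !xpair_eqE !eqxx /= andbT.
  have -> : u == x = false by apply/eqP => ux; rewrite -ux uvD in xvD.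
  have -> : v == y = false by apply/eqP => vy; rewrite -vy uvD in uyD.
  by rewrite andbF.
apply/BdkP; split=> [i|j].
  have := degX_togs D i us; rewrite -/(fill (x, y) D (u, v)) /=.
  by rewrite uvD (negPf xvD) (negPf uyD) /= -[d i]DX /=; do !case: (_ == _); lia.
have := degY_togs D j us; rewrite -/(fill (x, y) D (u, v)) /=.
by rewrite uvD (negPf xvD) (negPf uyD) /= -[k j]DY /=; do !case: (_ == _); lia.
Qed.

End Fill.

(** * Counting excess graphs; existence of helpers *)

Section Counting.
Variables (n m : nat) (d : 'I_n -> nat) (k : 'I_m -> nat) (Delta M : nat).
Notation E := ('I_n * 'I_m)%type.
Notation Om := (Bdk d k).
Hypotheses (dD : forall i, d i <= Delta) (kD : forall j, k j <= Delta).
Hypotheses (d1 : forall i, 1 <= d i) (k1 : forall j, 1 <= k j).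
Hypotheses (Md : M = \sum_i d i) (DM : 9 * Delta ^ 2 <= M) (D3 : 3 <= Delta).

Lemma card_Bdk B : B \in Om -> #|B| = M.
Proof.
by move=> /BdkP[BX _]; rewrite card_sum_degX Md; apply: eq_bigr.
Qed.

Lemma sum_eq1 (I : finType) (a : I) : \sum_i (a == i) = 1.
Proof. by rewrite (bigD1 a) //= eqxx big1 // => i /negPf; rewrite eq_sym => ->. Qed.

Lemma card_excess q L : L \in excess d k q -> #|L| = M.+1.
Proof.
move=> /excessP[LX _]; rewrite card_sum_degX Md (eq_bigr _ (fun i _ => LX i)).
by rewrite big_split /= sum_eq1 addn1.
Qed.

Lemma card_deficit q D : D \in deficit d k q -> #|D|.+1 = M.
Proof.
move=> /deficitP[DX _]; rewrite card_sum_degX Md -(eq_bigr _ (fun i _ => DX i)).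
by rewrite big_split /= sum_eq1 addn1.
Qed.

(* L is turned into a member of Bdk by removing one edge xb at x, one edge ay at y and an
   edge uv far from both, and adding ub and av. *)
Lemma excess_repair q L : L \in excess d k q ->
  exists B e1 e2, [/\ B \in Om, e1 \in B, e2 \in B &
    L = togs B [:: e2; e1; (e1.1, e2.2); (e2.1, q.2); (q.1, e1.2)]].
Proof.
case: q => x y LO; have /excessP[LX LY] := LO.
(* Row x has degree d x + 1 >= 2 in L, so it has an edge other than (x, y); the same holds for
   column y below. *)
have [b xbL byn] : exists2 b, (x, b) \in L & b != y.
  have : 0 < #|[set e in L | e.1 == x] :\ (x, y)|.
    have h : degX L x = _ := cardsD1 (x, y) _.
    move: h (leq_b1 ((x, y) \in [set e in L | e.1 == x])) (d1 x); rewrite LX eqxx.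
    by rewrite [nat_of_bool true]/=; move: (nat_of_bool _) #|_ :\ _|; lia.
  rewrite card_gt0 => /set0Pn[[x' b]]; rewrite !inE /= => /and3P[h xbL /eqP ex].
  by subst x'; exists b => //; apply: contraNneq h => ->.
have [a ayL axn] : exists2 a, (a, y) \in L & a != x.
  have : 0 < #|[set e in L | e.2 == y] :\ (x, y)|.
    have h : degY L y = _ := cardsD1 (x, y) _.
    move: h (leq_b1 ((x, y) \in [set e in L | e.2 == y])) (k1 y); rewrite LY eqxx.
    by rewrite [nat_of_bool true]/=; move: (nat_of_bool _) #|_ :\ _|; lia.
  rewrite card_gt0 => /set0Pn[[a y']]; rewrite !inE /= => /and3P[h ayL /eqP ey].
  by subst y'; exists a => //; apply: contraNneq h => ->.
(* Degrees in L are at most Delta + 1, and 2 (Delta + 1)^2 < M + 1 follows from 9 Delta^2 <= M. *)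
have [|||[u v] /= [uvL hr hc]] := @far_edge _ _ L Delta.+1 _ _ [:: a] [:: b].
- by move=> i; rewrite LX; have := dD i; case: (_ == _) => /=; lia.
- by move=> j; rewrite LY; have := kD j; case: (_ == _) => /=; lia.
- by rewrite (card_excess LO) /=; nia.
have avL : (a, v) \notin L by apply: hr; rewrite inE.
have ubL : (u, b) \notin L by apply: hc; rewrite inE.
have us : uniq [:: (x, b); (a, y); (u, v); (u, b); (a, v)].
  have xu : x == u = false by apply/eqP => xu; rewrite xu (negPf ubL) in xbL.
  have au : a == u = false by apply/eqP => au; rewrite au uvL in avL.
  have yv : y == v = false by apply/eqP => yv; rewrite yv (negPf avL) in ayL.
  have vb : v == b = false by apply/eqP => vb; rewrite vb (negPf ubL) in uvL.
  by rewrite /= !inE !xpair_eqE [x == a]eq_sym [u == a]eq_sym (negPf axn) xu au yv vb !andbF.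
pose B := togs L [:: (x, b); (a, y); (u, v); (u, b); (a, v)].
have inB e : e \in B = (e \in L) (+) (e \in [:: (x, b); (a, y); (u, v); (u, b); (a, v)]).
  exact: in_togs us.
exists B, (u, b), (a, v); split => /=.
- apply/BdkP; split=> [i|j].
    have := degX_togs L i us; rewrite -/B LX /=.
    by rewrite xbL ayL uvL (negPf ubL) (negPf avL) /=; do !case: (_ == _); lia.
  have := degY_togs L j us; rewrite -/B LY /=.
  by rewrite xbL ayL uvL (negPf ubL) (negPf avL) /=; do !case: (_ == _); lia.
- by rewrite inB (negPf ubL) !inE eqxx !orbT.
- by rewrite inB (negPf avL) !inE eqxx !orbT.
by rewrite -[LHS](togs_rev_inv [:: (x, b); (a, y); (u, v); (u, b); (a, v)]).
Qed.

(** For fixed q, [excess_repair] makes L a function of a member B of Bdk and two edges of B. *)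
Lemma card_excess_le q : #|excess d k q| <= #|Om| * M ^ 2.
Proof.
pose S := [set w : {set E} * (E * E) | [&& w.1 \in Om, w.2.1 \in w.1 & w.2.2 \in w.1]].
pose F (w : {set E} * (E * E)) :=
  togs w.1 [:: w.2.2; w.2.1; (w.2.1.1, w.2.2.2); (w.2.2.1, q.2); (q.1, w.2.1.2)].
have -> : #|Om| * M ^ 2 = #|S|.
  have -> : #|S| = \sum_(B in Om) \sum_(e in setX B B) 1.
    rewrite pair_big_dep /= -sum1_card; apply: eq_bigl => -[B [e1 e2]].
    by rewrite !inE.
  rewrite -sum_nat_const; apply: eq_bigr => B BO.
  by rewrite sum1_card cardsX card_Bdk // mulnn.
apply: leq_trans (leq_imset_card F S); rewrite subset_leq_card //.
apply/subsetP=> L /excess_repair[B [e1 [e2 [BO e1B e2B ->]]]].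
by apply/imsetP; exists (B, (e1, e2)); rewrite // inE /= BO e1B e2B.
Qed.

Lemma deg_deficit q D : D \in deficit d k q ->
  (forall i, degX D i <= Delta) /\ (forall j, degY D j <= Delta).
Proof.
move=> /deficitP[DX DY]; split=> i.
  by apply: leq_trans (dD i); rewrite -DX leq_addr.
by apply: leq_trans (kD i); rewrite -DY leq_addr.
Qed.

(** Five is what [filled_hop] requires; 5 Delta^2 < M - 1 holds because 9 Delta^2 <= M. *)
Lemma far_edge_deficit q D rows cols : D \in deficit d k q -> size rows + size cols <= 5 ->
  exists e, [/\ e \in D, {in rows, forall x, (x, e.2) \notin D} &
    {in cols, forall y, (e.1, y) \notin D}].
Proof.
move=> DO h; have [h1 h2] := deg_deficit DO; apply: (far_edge h1 h2).
have := card_deficit DO; have := leq_mul h (leqnn (Delta ^ 2)).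
have : 0 < Delta ^ 2 by rewrite expn_gt0 (leq_trans _ D3).
move: DM; rewrite -[_ < #|D|]ltnS => h3 h4 h5 ->; apply: leq_trans h3.
by move: h4 h5; set S := Delta ^ 2; set a := (_ * S); clearbody a; clearbody S; lia.
Qed.

(** An arbitrary choice, but a function of q and D only. The default [q] is never reached on deficit
    graphs, by [helperP]. *)
Definition helper (q : E) (D : {set E}) : E := odflt q [pick e | is_helper q D e].

Lemma helperP q D : D \in deficit d k q -> is_helper q D (helper q D).
Proof.
move=> DO; rewrite /helper; case: pickP => //= noh.
have [|e [eD h1 h2]] := @far_edge_deficit q D [:: q.1] [:: q.2] DO; first by [].
by have := noh e; rewrite /is_helper eD h1 ?h2 // inE.
Qed.

End Counting.

(** * Switches that exchange a helper or move the hole *)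

Section Switch.
Variables (n m : nat).
Notation E := ('I_n * 'I_m)%type.
Implicit Types (B D : {set E}) (q e h : E).

Lemma switch_uniq B e1 e2 : switch_ok B e1 e2 -> uniq [:: e1; e2; (e1.1, e2.2); (e2.1, e1.2)].
Proof.
case: e1 e2 => a b [u v] /and4P[/= au bv _ _].
by rewrite /= !inE !xpair_eqE [u == a]eq_sym [v == b]eq_sym (negPf au) (negPf bv) !andbF.
Qed.

Lemma switchE B e1 e2 : e1 \in B -> e2 \in B -> switch_ok B e1 e2 ->
  switch B e1 e2 = togs B [:: e1; e2; (e1.1, e2.2); (e2.1, e1.2)].
Proof.
move=> e1B e2B ok; have us := switch_uniq ok; rewrite /switch ok; case/and4P: ok.
case: e1 us e1B => a b; case: e2 e2B => u v uvB us abB /= au bv avB ubB.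
have ne e e' : e \in B -> e' \notin B -> e == e' = false.
  by move=> eB e'B; apply/eqP=> ee; rewrite ee (negPf e'B) in eB.
apply/setP=> z; rewrite in_togs //.
rewrite !inE.
have [->|z1] := eqVneq z (a, b); first by rewrite abB (ne _ (a, v) abB avB) (ne _ (u, b) abB ubB) !andbF.
have [->|z2] := eqVneq z (u, v); first by rewrite uvB (ne _ (a, v) uvB avB) (ne _ (u, b) uvB ubB).
have [->|z3] := eqVneq z (a, v); first by rewrite (negPf avB) orbT.
have [->|z4] := eqVneq z (u, b); first by rewrite (negPf ubB) orbT.
by rewrite /= orbF addbF.
Qed.

Lemma switch_out B e1 e2 : ~~ switch_ok B e1 e2 -> switch B e1 e2 = B.
Proof. by rewrite /switch => /negPf->. Qed.

Lemma degX_switch B e1 e2 i : e1 \in B -> e2 \in B -> degX (switch B e1 e2) i = degX B i.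
Proof.
move=> e1B e2B; have [ok|/switch_out->//] := boolP (switch_ok B e1 e2).
rewrite (switchE e1B e2B ok); have := degX_togs B i (switch_uniq ok).
have [_ _ n1 n2] := and4P ok; rewrite /= e1B e2B (negPf n1) (negPf n2) /=.
by do !case: (_ == _); lia.
Qed.

Lemma degY_switch B e1 e2 j : e1 \in B -> e2 \in B -> degY (switch B e1 e2) j = degY B j.
Proof.
move=> e1B e2B; have [ok|/switch_out->//] := boolP (switch_ok B e1 e2).
rewrite (switchE e1B e2B ok); have := degY_togs B j (switch_uniq ok).
have [_ _ n1 n2] := and4P ok; rewrite /= e1B e2B (negPf n1) (negPf n2) /=.
by do !case: (_ == _); lia.
Qed.

Lemma switch_Bdk d k B e1 e2 : e1 \in B -> e2 \in B -> (switch B e1 e2 \in Bdk d k) = (B \in Bdk d k).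
Proof.
move=> e1B e2B; rewrite !inE /in_Bdk; congr (_ && _); apply: eq_forallb => i.
  by rewrite degX_switch.
by rewrite degY_switch.
Qed.

Definition compat D h e := (e.1, h.2) \notin D.

(** The graph between the two switches that exchange helper h for helper e. With q = (x, y), h = (u,
    v), e = (u', v'), it is D without h and e, with (x, v'), (u', v) and (u, y) added. *)
Definition mid q D h e : {set E} :=
  togs (fill q D h) [:: (q.1, h.2); e; (q.1, e.2); (e.1, h.2)].

Section Paths.
Variables (q : E) (D : {set E}) (h e : E).
Hypotheses (hh : is_helper q D h) (he : is_helper q D e) (che : compat D h e).

(** Any coincidence would identify an edge of D with a non-edge. *)
Lemma helper_neq : [/\ q.1 == h.1 = false, q.2 == h.2 = false, q.1 == e.1 = false,
  q.2 == e.2 = false & (h.1 == e.1 = false) * (h.2 == e.2 = false)].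
Proof.
case/and3P: hh; case/and3P: he; move: che; rewrite /compat.
case: q h e => x y [u v] [u' v'] /= h0 h1 h2 h3 h4 h5 h6.
split; [| | | |split]; apply/eqP => eq.
- by rewrite eq h4 in h5.
- by rewrite eq h4 in h6.
- by rewrite eq h1 in h2.
- by rewrite eq h1 in h3.
- by rewrite -eq h4 in h0.
by rewrite eq h1 in h0.
Qed.

Lemma in_fill z D' : (z \in fill q D' h) =
  (z \in D') (+) (z == h) (+) (z == (q.1, h.2)) (+) (z == (h.1, q.2)).
Proof. by rewrite /fill /togs /= !in_tog. Qed.

Lemma helper_neqs : (((q.1 == h.1 = false) * (q.2 == h.2 = false) * (q.1 == e.1 = false)) *
  ((q.2 == e.2 = false) * (h.1 == e.1 = false) * (h.2 == e.2 = false)) *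
  ((h.1 == q.1 = false) * (h.2 == q.2 = false) * (e.1 == q.1 = false)) *
  ((e.2 == q.2 = false) * (e.1 == h.1 = false) * (e.2 == h.2 = false))).
Proof.
have [n1 n2 n3 n4 [n5 n6]] := helper_neq.
by do !split; rewrite // eq_sym.
Qed.

Lemma switch_fill_mid :
  [/\ (q.1, h.2) \in fill q D h, e \in fill q D h & switch (fill q D h) (q.1, h.2) e = mid q D h e].
Proof.
have := helper_neqs; case/and3P: hh; case/and3P: he; move: che; rewrite /compat /mid.
have := in_fill; case: q h e => x y [u v] [u' v'] /= inF h0 h1 h2 h3 h4 h5 h6 ns.
have A1 : (x, v) \in fill (x, y) D (u, v) by rewrite inF !xpair_eqE !ns !eqxx (negPf h5).
have A2 : (u', v') \in fill (x, y) D (u, v) by rewrite inF !xpair_eqE !ns h1.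
split=> //; rewrite switchE //; apply/and4P; split => /=; rewrite ?ns //.
  by rewrite inF !xpair_eqE !ns ?eqxx /= (negPf h2).
by rewrite inF !xpair_eqE !ns ?eqxx /= (negPf h0).
Qed.

Lemma in_mid z : (z \in mid q D h e) = (z \in fill q D h) (+) (z == (q.1, h.2)) (+) (z == e)
  (+) (z == (q.1, e.2)) (+) (z == (e.1, h.2)).
Proof. by rewrite /mid /togs /= !in_tog. Qed.

Lemma switch_mid_fill :
  [/\ (e.1, h.2) \in mid q D h e, (h.1, q.2) \in mid q D h e, (q.1, e.2) \in mid q D h e &
    switch (mid q D h e) (e.1, h.2) (h.1, q.2) = fill q D e].
Proof.
have := helper_neqs; case/and3P: hh; case/and3P: he; move: che; rewrite /compat.
have := in_mid; have := in_fill; case: q h e => x y [u v] [u' v'] /= inF inM h0 h1 h2 h3 h4 h5 h6 ns.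
have A1 : (u', v) \in mid (x, y) D (u, v) (u', v') by rewrite inM inF !xpair_eqE !ns !eqxx (negPf h0).
have A2 : (u, y) \in mid (x, y) D (u, v) (u', v') by rewrite inM inF !xpair_eqE !ns !eqxx (negPf h6).
have A3 : (x, v') \in mid (x, y) D (u, v) (u', v') by rewrite inM inF !xpair_eqE !ns !eqxx (negPf h2).
split=> //; rewrite switchE //; first last.
  apply/and4P; split => /=; rewrite ?ns //.
    by rewrite inM inF !xpair_eqE !ns ?eqxx /= (negPf h3).
  by rewrite inM inF !xpair_eqE !ns ?eqxx /= h4.
apply/setP=> z; rewrite /mid /fill /togs /= !in_tog.
by do !case: (_ == _); case: (_ \in _).
Qed.

End Paths.

(** With the helper (u, v) kept, moving the hole from (x, y) to (x, b) along e' = (a, b) is a single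
    switch: (u, y) and (a, b) become (u, b) and (a, y). *)
Lemma switch_fill q D e e' : is_helper q D e -> e' \in D -> (e'.1, q.2) \notin D ->
  (e.1, e'.2) \notin D ->
  [/\ (e.1, q.2) \in fill q D e, e' \in fill q D e, (q.1, e.2) \in fill q D e,
    is_helper (q.1, e'.2) (tog (tog D e') (e'.1, q.2)) e &
    switch (fill q D e) (e.1, q.2) e' = fill (q.1, e'.2) (tog (tog D e') (e'.1, q.2)) e].
Proof.
have inF z : (z \in fill q D e) =
  (z \in D) (+) (z == e) (+) (z == (q.1, e.2)) (+) (z == (e.1, q.2)).
  by rewrite /fill /togs /= !in_tog.
case/and3P; case: q e e' inF => x y [u v] [a b] /= inF uvD xvD uyD abD ayD ubD.
have f1 : x == u = false by apply/eqP => eq; rewrite eq uvD in xvD.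
have f2 : y == v = false by apply/eqP => eq; rewrite eq uvD in uyD.
have f3 : u == a = false by apply/eqP => eq; rewrite eq abD in ubD.
have f4 : b == v = false by apply/eqP => eq; rewrite eq uvD in ubD.
have f5 : b == y = false by apply/eqP => eq; rewrite -eq abD in ayD.
have s1 : u == x = false by rewrite eq_sym.
have s2 : v == y = false by rewrite eq_sym.
have s3 : a == u = false by rewrite eq_sym.
have s4 : v == b = false by rewrite eq_sym.
have s5 : y == b = false by rewrite eq_sym.
have A1 : (u, y) \in fill (x, y) D (u, v).
  by rewrite inF !xpair_eqE ?(f1, f2, s1, s2) !eqxx (negPf uyD).
have A2 : (a, b) \in fill (x, y) D (u, v).
  by rewrite inF !xpair_eqE ?(s3, f4) abD /= !andbF.
have A3 : (x, v) \in fill (x, y) D (u, v).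
  by rewrite inF !xpair_eqE ?(f1, s2) !eqxx (negPf xvD).
split=> //.
  by rewrite /is_helper !in_tog !xpair_eqE /= uvD (negPf xvD) (negPf ubD) f3 s4 s2 f5 !eqxx !andbF.
rewrite switchE //.
  apply/setP=> z; rewrite /fill /togs /= !in_tog.
  by do !case: (_ == _); case: (_ \in _).
apply/and4P; split; rewrite /= ?f3 ?s5 //.
  by rewrite inF !xpair_eqE s1 f4 f5 !andbF (negPf ubD).
by rewrite inF !xpair_eqE s3 f2 (negPf ayD) !andbF.
Qed.

Lemma fill_added q D h : is_helper q D h -> (h.1, q.2) \in fill q D h.
Proof.
case/and3P; case: q h => x y [u v] /= uvD xvD uyD.
rewrite /fill /togs /= !in_tog !xpair_eqE !eqxx (negPf uyD) /=.
have -> : u == x = false by apply/eqP => eq; rewrite -eq uvD in xvD.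
by have -> : y == v = false by apply/eqP => eq; rewrite eq uvD in uyD.
Qed.

(** The two ends of a path: if the hole is a non-edge, filling it directly and filling it through a
    helper differ by one switch. *)
Lemma switch_tog q D h : q \notin D -> is_helper q D h ->
  [/\ q \in tog D q, h \in tog D q & switch (tog D q) q h = fill q D h].
Proof.
move=> qD /and3P[]; case: q h qD => x y [u v] /= qD uvD xvD uyD.
have f1 : x == u = false by apply/eqP => eq; rewrite eq uvD in xvD.
have f2 : y == v = false by apply/eqP => eq; rewrite eq uvD in uyD.
have A1 : (x, y) \in tog D (x, y) by rewrite in_tog eqxx (negPf qD).
have A2 : (u, v) \in tog D (x, y) by rewrite in_tog xpair_eqE eq_sym f1 uvD.
split=> //; rewrite switchE //.
  apply/setP=> z; rewrite /fill /togs /= !in_tog.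
  by do !case: (_ == _); case: (_ \in _).
apply/and4P; split; rewrite /= ?f1 ?f2 //.
  by rewrite in_tog xpair_eqE [v == y]eq_sym f2 andbF (negPf xvD).
by rewrite in_tog xpair_eqE [u == x]eq_sym f1 (negPf uyD).
Qed.

End Switch.

Local Open Scope ring_scope.

(** * The flow *)

Section Flow.
Variables (R : realFieldType) (n m : nat) (d : 'I_n -> nat) (k : 'I_m -> nat).
Notation E := ('I_n * 'I_m)%type.
Notation Om := (Bdk d k).
Notation pairs := ({set E} * {set E})%type.
Notation invs := ({ffun E -> E} * {ffun E -> E})%type.

Definition paired (t : pairs * invs) : bool :=
  [&& t.1.1 \in Om, t.1.2 \in Om, pairing fst t.1.1 t.1.2 t.2.1
    & pairing snd t.1.1 t.1.2 t.2.2].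

Definition weight (p : pairs) : R := (#|pairings fst p.1 p.2| * #|pairings snd p.1 p.2|)%:R^-1.

Lemma weight_ge0 p : 0 <= weight p.
Proof. by rewrite invr_ge0 ler0n. Qed.

(** Inserts the uniform choice of the involutions. The weights of a pair sum to 1 because
    [pairings_neq0] keeps the cardinals in the denominator positive. *)
Lemma sum_paired (h : pairs -> R) :
  \sum_(A in Om) \sum_(B in Om) h (A, B) = \sum_(t | paired t) weight t.1 * h t.1.
Proof.
pose Q (p : pairs) (ab : invs) := pairing fst p.1 p.2 ab.1 && pairing snd p.1 p.2 ab.2.
rewrite pair_big /= (eq_bigr (fun p => h p)) => [|[] //].
have -> : \sum_(t | paired t) weight t.1 * h t.1 =
    \sum_(p | (p.1 \in Om) && (p.2 \in Om)) \sum_(ab | Q p ab) weight p * h p.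
  rewrite pair_big_dep /=; apply: eq_bigl => -[[A B] [a b]].
  by rewrite /paired /= andbA.
apply: eq_bigr => -[A B] /= /andP[AO BO].
rewrite (eq_bigl [in setX (pairings fst A B) (pairings snd A B)]); last first.
  by move=> [a b]; rewrite !inE.
rewrite sumr_const cardsX -mulr_natl mulrA /weight /= divff ?mul1r //.
rewrite pnatr_eq0 -lt0n muln_gt0 !card_gt0.
move/BdkP: AO => [AX AY]; move/BdkP: BO => [BX BY].
apply/andP; split; apply/set0Pn.
  have [|a pa] := @pairings_neq0 _ _ (fst : E -> _) A B; last by exists a; rewrite inE.
  by move=> i; move: (AX i); rewrite -BX.
have [|a pa] := @pairings_neq0 _ _ (snd : E -> _) A B; last by exists a; rewrite inE.
by move=> i; move: (AY i); rewrite -BY.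
Qed.

(* The order in which orbits are flipped must depend on the involutions only: this is what
   makes [flip] below injective. *)
Definition rk (ab : invs) (e : E) : 'I_#|{: E}| := enum_rank (fingraph.root (adj ab.1 ab.2) e).

(** Not being fixed by [ab.1] expresses membership in the symmetric difference without mentioning A
    and B. *)
Definition orbits_below (ab : invs) (j : nat) : {set E} := [set e | (ab.1 e != e) && (rk ab e < j)%N].

Definition orbit_at (ab : invs) (j : 'I_#|{: E}|) : {set E} := [set e | (ab.1 e != e) && (rk ab e == j)].

Lemma orbits_belowS ab (j : 'I_#|{: E}|) :
  orbits_below ab j.+1 = symd (orbits_below ab j) (orbit_at ab j).
Proof.
apply/setP=> e; rewrite in_symd !inE ltnS leq_eqVlt -val_eqE /=.
by case: ltngtP => _; rewrite ?andbF ?andbT ?addbF ?addFb.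
Qed.

Section Paired.
Variable t : pairs * invs.
Hypothesis pt : paired t.
Let AO : t.1.1 \in Om. Proof. by case/and4P: pt. Qed.
Let BO : t.1.2 \in Om. Proof. by case/and4P: pt. Qed.
Let pal : pairing fst t.1.1 t.1.2 t.2.1. Proof. by case/and4P: pt. Qed.
Let pbe : pairing snd t.1.1 t.1.2 t.2.2. Proof. by case/and4P: pt. Qed.

Lemma fixed_symd e : (t.2.1 e != e) = (e \in symd t.1.1 t.1.2).
Proof. by rewrite (pairing_id pal) negbK. Qed.

Lemma symd_inv e : (t.2.1 e \in symd t.1.1 t.1.2) = (e \in symd t.1.1 t.1.2) /\
  (t.2.2 e \in symd t.1.1 t.1.2) = (e \in symd t.1.1 t.1.2).
Proof.
rewrite !in_symd (pairing_memL pal) (pairing_memL pbe) (pairing_memR pal) (pairing_memR pbe).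
by rewrite addbC.
Qed.

Lemma rkE x y : (rk t.2 x == rk t.2 y) = connect (adj t.2.1 t.2.2) x y.
Proof.
rewrite (inj_eq enum_rank_inj) root_connect //.
exact: adj_sym (pairingK pal) (pairingK pbe).
Qed.

Lemma rk_inv e : rk t.2 (t.2.1 e) = rk t.2 e /\ rk t.2 (t.2.2 e) = rk t.2 e.
Proof.
split; apply/esym/eqP; rewrite rkE; apply: connect1; rewrite /adj eqxx //.
by rewrite orbT.
Qed.

Lemma orbits_below_inv j e :
  (t.2.1 e \in orbits_below t.2 j) = (e \in orbits_below t.2 j) /\
  (t.2.2 e \in orbits_below t.2 j) = (e \in orbits_below t.2 j).
Proof.
have [r1 r2] := rk_inv e; have [s1 s2] := symd_inv e.
by rewrite !inE !fixed_symd r1 r2 s1 s2.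
Qed.

Lemma orbits_below_sub j : orbits_below t.2 j \subset symd t.1.1 t.1.2.
Proof. by apply/subsetP=> e; rewrite inE fixed_symd => /andP[]. Qed.

Lemma orbits_below_all : symd t.1.1 (orbits_below t.2 #|{: E}|) = t.1.2.
Proof.
apply/setP=> e; rewrite in_symd inE ltn_ord andbT fixed_symd in_symd.
by do 2 case: (_ \in _).
Qed.

Lemma orbits_below0 : symd t.1.1 (orbits_below t.2 0) = t.1.1.
Proof. by apply/setP=> e; rewrite in_symd inE ltn0 andbF addbF. Qed.

Definition flip j : pairs * invs :=
  ((symd t.1.1 (orbits_below t.2 j), symd t.1.2 (orbits_below t.2 j)), t.2).

Lemma paired_flip j : paired (flip j).
Proof.
have c1 e := (orbits_below_inv j e).1; have c2 e := (orbits_below_inv j e).2.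
have sub := orbits_below_sub j.
have sub' : orbits_below t.2 j \subset symd t.1.2 t.1.1 by rewrite [symd t.1.2 _]symdC.
apply/and4P; split => /=.
- apply/BdkP; move/BdkP: AO => [h1 h2]; split=> i; [rewrite -h1|rewrite -h2].
    exact: card_key_symd pal c1 sub _.
  exact: card_key_symd pbe c2 sub _.
- apply/BdkP; move/BdkP: BO => [h1 h2]; split=> i; [rewrite -h1|rewrite -h2].
    exact: card_key_symd (pairing_sym pal) c1 sub' _.
  exact: card_key_symd (pairing_sym pbe) c2 sub' _.
- exact: pairing_symd pal c1.
- exact: pairing_symd pbe c2.
Qed.

Lemma weight_flip j : weight (flip j).1 = weight t.1.
Proof.
have c1 e := (orbits_below_inv j e).1; have c2 e := (orbits_below_inv j e).2.
have sub := orbits_below_sub j.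
by rewrite /weight /= (card_pairings_symd pal c1 sub) (card_pairings_symd pbe c2 sub).
Qed.

Lemma orbit_at_dorbit e0 : e0 \in t.1.1 :\: t.1.2 ->
  orbit_at t.2 (rk t.2 e0) = dorbit t.2.1 t.2.2 e0.
Proof.
move=> e0AB; apply/setP=> e; rewrite inE fixed_symd eq_sym rkE -(dorbit_connect pal pbe).
by apply: andb_idl; apply: (subsetP (dorbit_sub pal pbe e0AB)).
Qed.

Lemma orbit_at_neq0 j : orbit_at t.2 j != set0 ->
  exists2 e0, e0 \in t.1.1 :\: t.1.2 & rk t.2 e0 = j.
Proof.
case/set0Pn=> e; rewrite inE fixed_symd => /andP[eAB /eqP ej].
have [eA|eA] := boolP (e \in t.1.1).
  exists e => //; move: eAB; rewrite in_symd inE eA.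
  by case: (_ \in _).
exists (t.2.1 e); last by rewrite (rk_inv e).1.
rewrite (pairing_memD pal) inE eA; move: eAB; rewrite in_symd (negPf eA).
by case: (_ \in _).
Qed.

Lemma sum_card_orbit_at : (\sum_j #|orbit_at t.2 j| = #|symd t.1.1 t.1.2|)%N.
Proof.
rewrite -[in RHS]sum1_card (partition_big (rk t.2) xpredT) //=.
apply: eq_bigr => j _; rewrite -sum1_card; apply: eq_bigl => e.
by rewrite inE fixed_symd.
Qed.

End Paired.

Lemma card_symd_le (A B : {set E}) : (#|symd A B| <= #|A| + #|B|)%N.
Proof.
apply: leq_trans (leq_card_setU A B); rewrite subset_leq_card //.
by apply/subsetP=> e; rewrite in_symd !inE; do 2 case: (_ \in _).
Qed.

Variable M : nat.
Hypothesis cardM : forall B, B \in Om -> #|B| = M.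
Variable f : {set E} -> R.

(** Weighted Cauchy-Schwarz with the orbit sizes as weights; they add up to the size of the
    symmetric difference, at most 2 M. The division by the orbit size cancels the path length in
    [orbit_path]. *)
Lemma sqr_flip_orbits t : paired t ->
  (f t.1.1 - f t.1.2) ^+ 2 <= (2 * M)%:R *
    \sum_(j < #|{: E}|) (f (flip t j).1.1 - f (symd (flip t j).1.1 (orbit_at t.2 j))) ^+ 2 / #|orbit_at t.2 j|%:R.
Proof.
move=> pt; have [AO BO _ _] := and4P pt.
pose a (j : 'I_#|{: E}|) := f (flip t j).1.1 - f (symd (flip t j).1.1 (orbit_at t.2 j)).
have -> : f t.1.1 - f t.1.2 = \sum_j a j.
  rewrite -{1}(orbits_below0 t) -{1}(orbits_below_all pt).
  pose v j := f (symd t.1.1 (orbits_below t.2 j)).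
  rewrite -[LHS]opprK opprB -(@telescope_sumr _ 0 _ v) // -sumrN big_mkord.
  apply: eq_bigr => j _; rewrite opprB /v /a orbits_belowS symdA.
  by [].
apply: le_trans (@sqr_sum_weighted _ _ (fun j => #|orbit_at t.2 j|%:R) a _ _) _ => //.
  move=> j /eqP; rewrite pnatr_eq0 cards_eq0 => /eqP o0.
  rewrite /a o0; apply/eqP; rewrite subr_eq0; apply/eqP; congr f.
  by apply/setP=> e; rewrite [RHS]in_symd in_set0 addbF.
apply: ler_wpM2r.
  by apply: sumr_ge0 => j _; rewrite mulr_ge0 ?sqr_ge0 // invr_ge0 ler0n.
rewrite -natr_sum (sum_card_orbit_at pt) ler_nat.
by apply: leq_trans (card_symd_le _ _) _; rewrite !cardM // mul2n addnn.
Qed.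

(** For fixed j, flipping the first j orbits is an injective and weight-preserving self-map of the
    paired data. The intermediate pair is thus distributed like the initial one and may replace
    it. *)
Lemma sum_flip_orbits :
  \sum_(A in Om) \sum_(B in Om) (f A - f B) ^+ 2 <=
  (2 * M)%:R * \sum_(t | paired t) weight t.1 *
    \sum_(e0 in t.1.1 :\: t.1.2)
      (f t.1.1 - f (symd t.1.1 (dorbit t.2.1 t.2.2 e0))) ^+ 2 / #|dorbit t.2.1 t.2.2 e0|%:R.
Proof.
pose h (t : pairs * invs) (j : 'I_#|{: E}|) : R :=
  (f t.1.1 - f (symd t.1.1 (orbit_at t.2 j))) ^+ 2 / #|orbit_at t.2 j|%:R.
have h0 t j : 0 <= h t j by rewrite mulr_ge0 ?sqr_ge0 // invr_ge0 ler0n.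
rewrite (sum_paired (fun p => (f p.1 - f p.2) ^+ 2)).
apply: (@le_trans _ _ (\sum_(t | paired t) weight t.1 * ((2 * M)%:R * \sum_(j < #|{: E}|) h (flip t j) j))).
  apply: ler_sum => t pt; apply: ler_wpM2l; first exact: weight_ge0.
  exact: sqr_flip_orbits.
rewrite (eq_bigr (fun t => (2 * M)%:R * \sum_(j < #|{: E}|) weight t.1 * h (flip t j) j)); last first.
  by move=> t _; rewrite mulrCA mulr_sumr.
rewrite -mulr_sumr; apply: ler_wpM2l; first exact: ler0n.
rewrite exchange_big /=.
apply: (@le_trans _ _ (\sum_j \sum_(t | paired t) weight t.1 * h t j)).
  apply: ler_sum => j _.
  apply: (@ler_sum_inj _ _ _ _ _ (fun t => flip t j)) => [s t _ _|||].
  - case: s t => [[A B] ab] [[A' B'] ab'] [] + + abE; rewrite -abE => e1 e2.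
    congr (_, _, _); first by rewrite -[A](symdK (orbits_below ab j)) e1 symdK.
    by rewrite -[B](symdK (orbits_below ab j)) e2 symdK.
  - by move=> t pt; apply: paired_flip.
  - by move=> t _; rewrite mulr_ge0 // weight_ge0.
  - by move=> t pt; rewrite (weight_flip pt).
rewrite exchange_big /=; apply: ler_sum => t pt.
rewrite -mulr_sumr; apply: ler_wpM2l; first exact: weight_ge0.
(* The sum over all e0 contains at least one representative of every nonempty orbit, and its other
   terms are nonnegative. *)
rewrite [leRHS](partition_big (rk t.2) xpredT) //=; apply: ler_sum => j _.
have [o0|/(orbit_at_neq0 pt)[e0 e0AB e0j]] := eqVneq (orbit_at t.2 j) set0.
  rewrite /h o0 cards0 invr0 mulr0 sumr_ge0 // => e _.
  by rewrite mulr_ge0 ?sqr_ge0 // invr_ge0 ler0n.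
rewrite /h -e0j (orbit_at_dorbit pt e0AB).
apply: (ler_sum1 (F := fun e0 => (f t.1.1 - f (symd t.1.1 (dorbit t.2.1 t.2.2 e0))) ^+ 2 /
  #|dorbit t.2.1 t.2.2 e0|%:R)); first by rewrite e0AB eqxx.
by move=> e _; rewrite mulr_ge0 ?sqr_ge0 // invr_ge0 ler0n.
Qed.

End Flow.

(** * Encoding the points of the flow and bounding its congestion *)

Section Encoding.
Variables (R : realFieldType) (n m : nat) (d : 'I_n -> nat) (k : 'I_m -> nat).
Notation E := ('I_n * 'I_m)%type.
Notation Om := (Bdk d k).
Notation pairs := ({set E} * {set E})%type.
Notation invs := ({ffun E -> E} * {ffun E -> E})%type.
Variable Phi : E -> {set E} -> R.
Hypothesis Phi0 : forall q D, 0 <= Phi q D.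

Notation paired := (paired d k).

Definition source (v : (pairs * invs) * (E * 'I_#|{: E}|)) : bool :=
  [&& paired v.1, v.2.1 \in v.1.1.1 :\: v.1.1.2 & (v.2.2 < order (step v.1.2.1 v.1.2.2) v.2.1)%N].

Notation code := ((pairs * (E * E)) * invs)%type.

Definition code_pairX (u : code) := pairings fst (tog u.1.1.1 u.1.2.1) (tog u.1.1.2 u.1.2.1).
Definition code_pairY (u : code) := pairings snd (tog u.1.1.1 u.1.2.2) (tog u.1.1.2 u.1.2.2).

Definition code_base (z : pairs * (E * E)) : bool :=
  let q := (z.2.1.1, z.2.2.2) in
  [&& z.1.1 \in deficit d k q, z.1.2 \in excess d k q, z.2.1 \in z.1.2 & z.2.2 \in z.1.2].

Definition code_ok (u : code) : bool :=
  [&& code_base u.1, u.2.1 \in code_pairX u & u.2.2 \in code_pairY u].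

Definition encode (v : (pairs * invs) * (E * 'I_#|{: E}|)) : code :=
  let: (t, (e0, i)) := v in
  ((node t.2.1 t.2.2 t.1.1 e0 i, conode t.1.1 t.1.2 t.2.1 t.2.2 e0 i),
   (e0, iter i (step t.2.1 t.2.2) e0), t.2).

(** [node_decode] recovers A; then B follows from L = A + B + D, and i from e_i because the first
    iterates of e0 are distinct. *)
Lemma encode_inj : {in source &, injective encode}.
Proof.
move=> [[[A B] [a b]] [e0 i]] [[[A' B'] [a' b']] [e0' i']].
move=> /and3P[/= pt e0AB il] /and3P[/= pt' e0AB' il'].
case=> eD eL ee ei ea eb; subst e0' a' b'.
have [_ _ /= pal pbe] := and4P pt; have [_ _ /= pal' pbe'] := and4P pt'.
have eA : A = A'.
  by rewrite (node_decode pal pbe e0AB il) (node_decode pal' pbe' e0AB' il') eD.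
have eB : B = B'.
  move: eL; rewrite /conode eD -eA => /setP eL; apply/setP=> z.
  by have := eL z; rewrite !in_symd => /addIb/addbI.
have eii : i = i' by apply/val_inj/(iter_eq_node il il' ei).
by rewrite eA eB eii.
Qed.

Lemma encode_ok v : source v -> code_ok (encode v).
Proof.
case: v => [[[A B] [a b]] [e0 i]] /and3P[/= pt e0AB il].
have [/= AO BO pal pbe] := and4P pt.
apply/and3P; split => /=; rewrite ?inE /=.
- apply/and4P; split => /=.
  + exact: (node_deficit pal pbe AO BO e0AB il).
  + exact: (conode_excess pal pbe AO BO e0AB il).
  + exact: (e0_conode pal pbe e0AB il).
  + exact: (iter_conode pal pbe e0AB il).
- exact: (pairing_nodeX pal pbe e0AB il).
- exact: (pairing_nodeY pbe il).
Qed.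

Definition code_weight (u : code) : R := (#|code_pairX u| * #|code_pairY u|)%:R^-1.

Lemma encode_weight v : source v -> code_weight (encode v) = weight R v.1.1.
Proof.
case: v => [[[A B] [a b]] [e0 i]] /and3P[/= pt e0AB il].
have [/= AO BO pal pbe] := and4P pt.
by rewrite /code_weight /weight /code_pairX /code_pairY /=
  (card_pairings_nodeX pal pbe e0AB il) (card_pairings_nodeY pal pbe e0AB il).
Qed.

(** For fixed D, L, e0, e_i the weights of the admissible involutions sum to 1, or to 0 if there are
    none. This is the cancellation of the uniform choice. *)
Lemma sum_code :
  \sum_(u | code_ok u) code_weight u * Phi (u.1.2.1.1, u.1.2.2.2) u.1.1.1 <=
  \sum_(z | code_base z) Phi (z.2.1.1, z.2.2.2) z.1.1.
Proof.
pose Q (z : pairs * (E * E)) (ab : invs) :=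
  (ab.1 \in code_pairX (z, ab)) && (ab.2 \in code_pairY (z, ab)).
rewrite (eq_bigl (fun u : code => code_base u.1 && Q u.1 u.2)); last by move=> [z ab].
rewrite (eq_bigr (fun u : code => code_weight (u.1, u.2) * Phi (u.1.2.1.1, u.1.2.2.2) u.1.1.1));
  last by move=> [z ab].
rewrite -(pair_big_dep code_base Q
  (fun z ab => code_weight (z, ab) * Phi (z.2.1.1, z.2.2.2) z.1.1)) /=.
apply: ler_sum => -[[D L] [e0 e1]] _ /=.
set P := Phi _ _.
set X := pairings fst (tog D e0) (tog L e0); set Y := pairings snd (tog D e1) (tog L e1).
rewrite (eq_bigl [in setX X Y]); last by move=> [a b]; rewrite in_setX.
rewrite (eq_bigr (fun=> (#|X| * #|Y|)%:R^-1 * P)) //.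
rewrite sumr_const cardsX -[leLHS]mulr_natl mulrA.
have P0 : 0 <= P by apply: Phi0.
have [->|XY] := eqVneq (#|X| * #|Y|)%N 0%N; first by rewrite mul0r mul0r.
by rewrite divff ?mul1r // pnatr_eq0.
Qed.

Variables (Delta C : nat).
Hypotheses (dD : forall i, (d i <= Delta)%N) (kD : forall j, (k j <= Delta)%N).
Hypothesis excessC : forall q, (#|excess d k q| <= C)%N.

(** Given q and D, there are at most C graphs L. The edge e0 lies in the row of q and e_i in its
    column, where L has degree at most Delta + 1. *)
Lemma sum_code_base :
  \sum_(z | code_base z) Phi (z.2.1.1, z.2.2.2) z.1.1 <=
  (C * Delta.+1 ^ 2)%:R * \sum_q \sum_(D in deficit d k q) Phi q D.
Proof.
pose P (qD : E * {set E}) := qD.2 \in deficit d k qD.1.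
pose Q (qD : E * {set E}) (w : {set E} * (E * E)) :=
  [&& w.1 \in excess d k qD.1, w.2.1 \in [set e in w.1 | e.1 == qD.1.1]
    & w.2.2 \in [set e in w.1 | e.2 == qD.1.2]].
apply: (@le_trans _ _ (\sum_(y | P y.1 && Q y.1 y.2) Phi y.1.1 y.1.2)).
  apply: (@ler_sum_inj _ _ _ _ _ (fun z => (((z.2.1.1, z.2.2.2), z.1.1), (z.1.2, z.2)))) => //.
  - by move=> [[D L] [e0 e1]] [[D' L'] [e0' e1']] _ _ [_ _ -> -> -> ->].
  - move=> [[D L] [e0 e1]] /and4P[/= h1 h2 h3 h4].
    by rewrite /P /Q /= h1 h2 !inE h3 h4 !eqxx.
rewrite -(pair_big_dep P Q (fun qD _ => Phi qD.1 qD.2)) /=.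
rewrite [in leRHS]pair_big_dep /= [leRHS]mulr_sumr; apply: ler_sum => -[q D] /= _.
rewrite (eq_bigl (fun w : {set E} * (E * E) => (w.1 \in excess d k q) &&
  (w.2 \in setX [set e in w.1 | e.1 == q.1] [set e in w.1 | e.2 == q.2]))); last first.
  by move=> [L [e0 e1]]; rewrite /Q in_setX.
rewrite -(pair_big_dep [in excess d k q]
  (fun L w => w \in setX [set e in L | e.1 == q.1] [set e in L | e.2 == q.2])
  (fun _ _ => Phi q D)) /=.
apply: (@le_trans _ _ (\sum_(L in excess d k q) (Delta.+1 ^ 2)%:R * Phi q D)).
  apply: ler_sum => L /excessP[LX LY].
  rewrite sumr_const cardsX -[leLHS]mulr_natl ler_wpM2r // ler_nat.
  rewrite -[(#|_| * _)%N]/(degX L q.1 * degY L q.2)%N LX LY !eqxx -mulnn.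
  by apply: leq_mul; rewrite addn1 ltnS.
rewrite sumr_const -[leLHS]mulr_natl mulrA -natrM ler_wpM2r // ler_nat.
by rewrite leq_mul2r excessC orbT.
Qed.

Lemma sum_source :
  \sum_(t | paired t) weight R t.1 * \sum_(e0 in t.1.1 :\: t.1.2)
    \sum_(i < #|{: E}| | (i < order (step t.2.1 t.2.2) e0)%N)
      Phi (hole t.2.1 t.2.2 e0 i) (node t.2.1 t.2.2 t.1.1 e0 i) <=
  (C * Delta.+1 ^ 2)%:R * \sum_q \sum_(D in deficit d k q) Phi q D.
Proof.
apply: le_trans sum_code_base; apply: le_trans sum_code.
rewrite (eq_bigr (fun t : pairs * invs => \sum_(w : E * 'I_#|{: E}| |
   (w.1 \in t.1.1 :\: t.1.2) && (w.2 < order (step t.2.1 t.2.2) w.1)%N)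
   weight R t.1 * Phi (hole t.2.1 t.2.2 w.1 w.2) (node t.2.1 t.2.2 t.1.1 w.1 w.2))); last first.
  by move=> t _; rewrite pair_big_dep /= mulr_sumr.
rewrite pair_big_dep /=.
apply: (ler_sum_inj encode_inj encode_ok).
  by move=> u _; rewrite mulr_ge0 // invr_ge0 ler0n.
move=> v sv; rewrite (encode_weight sv).
by case: v sv => [[[A B] [a b]] [e0 i]] _.
Qed.

Variable M : nat.
Hypothesis cardM : forall B, B \in Om -> #|B| = M.
Variables (f : {set E} -> R) (g : E -> {set E} -> R).

(** The factor 4 M is 2 M from [sum_flip_orbits] times 2 from [orbit_path]; the orbit sizes cancel
    between these two bounds. *)
Theorem flow_bound :
  (forall q D, D \in deficit d k q -> q \notin D -> (g q D - f (tog D q)) ^+ 2 <= Phi q D) ->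
  (forall q D e, D \in deficit d k q -> e \in D -> (e.1, q.2) \notin D ->
     (g q D - g (q.1, e.2) (tog (tog D e) (e.1, q.2))) ^+ 2 <= Phi q D) ->
  \sum_(A in Om) \sum_(B in Om) (f A - f B) ^+ 2 <=
  (4 * M * C * Delta.+1 ^ 2)%:R * \sum_q \sum_(D in deficit d k q) Phi q D.
Proof.
move=> H1 H2; apply: (le_trans (sum_flip_orbits cardM f)).
have -> : (4 * M * C * Delta.+1 ^ 2)%:R = (2 * M)%:R * (2 * (C * Delta.+1 ^ 2)%:R) :> R.
  by rewrite -!natrM; congr _%:R; lia.
rewrite -mulrA ler_wpM2l // -mulrA.
apply: le_trans (ler_wpM2l _ sum_source) => //.
rewrite mulr_sumr; apply: ler_sum => t pt; have [AO BO pal pbe] := and4P pt.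
rewrite mulrCA ler_wpM2l ?weight_ge0 // mulr_sumr; apply: ler_sum => e0 e0AB.
rewrite ler_pdivrMr; last by rewrite ltr0n (card_dorbit pal pbe e0AB) addn_gt0 order_gt0.
by rewrite mulrC; apply: (orbit_path pal pbe AO BO e0AB Phi0 H1 H2).
Qed.

End Encoding.

Lemma sqr_sum5 (R : realFieldType) (a b c x y : R) :
  (a + b + c + x + y) ^+ 2 <= 5 * (a ^+ 2 + b ^+ 2 + c ^+ 2 + x ^+ 2 + y ^+ 2).
Proof.
rewrite -subr_ge0 (_ : _ - _ = (a - b) ^+ 2 + (a - c) ^+ 2 + (a - x) ^+ 2 + (a - y) ^+ 2 +
  (b - c) ^+ 2 + (b - x) ^+ 2 + (b - y) ^+ 2 + (c - x) ^+ 2 + (c - y) ^+ 2 + (x - y) ^+ 2).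
  by do 9 (apply: addr_ge0; last exact: sqr_ge0); apply: sqr_ge0.
by ring.
Qed.

(** * From hole moves to switches *)

Section Energy.
Variables (R : realFieldType) (n m : nat) (d : 'I_n -> nat) (k : 'I_m -> nat).
Variables (Delta M : nat).
Notation E := ('I_n * 'I_m)%type.
Notation Om := (Bdk d k).
Hypotheses (dD : forall i, (d i <= Delta)%N) (kD : forall j, (k j <= Delta)%N).
Hypotheses (Md : M = (\sum_i d i)%N) (DM : (9 * Delta ^ 2 <= M)%N) (D3 : (3 <= Delta)%N).
Variable f : {set E} -> R.

Definition switch_diff (Z : {set E}) (e1 e2 : E) : R := (f Z - f (switch Z e1 e2)) ^+ 2.
Notation F := switch_diff.

Definition energy : R := \sum_(Z in Om) \sum_(e1 in Z) \sum_(e2 in Z) F Z e1 e2.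

Lemma switch_diff_ge0 Z e1 e2 : 0 <= F Z e1 e2. Proof. exact: sqr_ge0. Qed.

Lemma energy_ge0 : 0 <= energy.
Proof. by do 3 (apply: sumr_ge0 => ? _); apply: switch_diff_ge0. Qed.

(** A switch together with one marker edge [c] of its starting graph determines the index. There are
    M choices of the marker, so each switch is used at most M times. *)
Lemma sum_switch_diff (I : finType) (P : pred I) (Zf : I -> {set E}) (a b c : I -> E) :
  (forall t, P t -> [/\ Zf t \in Om, a t \in Zf t, b t \in Zf t & c t \in Zf t]) ->
  {in P &, injective (fun t => (Zf t, (a t, (b t, c t))))} ->
  \sum_(t | P t) F (Zf t) (a t) (b t) <= M%:R * energy.
Proof.
move=> PZ inj.
have -> : M%:R * energy = \sum_(u : {set E} * (E * (E * E)) |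
    (u.1 \in Om) && ((u.2.1 \in u.1) && ((u.2.2.1 \in u.1) && (u.2.2.2 \in u.1)))) F u.1 u.2.1 u.2.2.1.
  rewrite -(pair_big_dep [in Om] (fun Z (w : E * (E * E)) =>
    (w.1 \in Z) && ((w.2.1 \in Z) && (w.2.2 \in Z))) (fun Z w => F Z w.1 w.2.1)) /=.
  rewrite /energy mulr_sumr; apply: eq_bigr => Z ZO.
  rewrite -(pair_big_dep [in Z] (fun _ (w : E * E) => (w.1 \in Z) && (w.2 \in Z))
    (fun e1 w => F Z e1 w.1)) /=.
  rewrite mulr_sumr; apply: eq_bigr => e1 _.
  rewrite -(pair_big_dep [in Z] (fun _ e3 => e3 \in Z) (fun e2 _ => F Z e1 e2)) /=.
  by rewrite mulr_sumr; apply: eq_bigr => e2 _; rewrite sumr_const (card_Bdk Md ZO) mulr_natl.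
apply: (ler_sum_inj inj) => [t /PZ[h1 h2 h3 h4]|u _|//]; first by rewrite /= h1 h2 h3 h4.
exact: switch_diff_ge0.
Qed.

Definition filled (q : E) (D : {set E}) : R := f (fill q D (helper q D)).
Notation g := filled.

Definition cand (q : E) (D : {set E}) (e : E) := is_helper q D e && compat D (helper q D) e.

Definition helper_energy (q : E) (D : {set E}) : R :=
  \sum_(e | cand q D e) (F (fill q D (helper q D)) (q.1, (helper q D).2) e +
    F (mid q D (helper q D) e) (e.1, (helper q D).2) ((helper q D).1, q.2)).
Notation H := helper_energy.

Definition hop (q : E) (D : {set E}) (e : E) := (e \in D) && ((e.1, q.2) \notin D).
Definition hop_hole (q e : E) : E := (q.1, e.2).
Definition hop_graph (q : E) (D : {set E}) (e : E) : {set E} := tog (tog D e) (e.1, q.2).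

Definition hop_energy (q : E) (D : {set E}) (e' : E) : R :=
  \sum_(e | is_helper q D e && ((e.1, e'.2) \notin D)) F (fill q D e) (e.1, q.2) e'.
Notation J := hop_energy.

Lemma hop_deficit q D e : D \in deficit d k q -> hop q D e ->
  hop_graph q D e \in deficit d k (hop_hole q e).
Proof.
case: q e => x y [a b] /deficitP[DX DY] /andP[/= abD ayD].
have us : uniq [:: (a, b); (a, y)].
  by rewrite /= inE xpair_eqE eqxx /= andbT; apply/eqP => eq; rewrite -eq abD in ayD.
apply/deficitP; split=> [i|j].
  have := degX_togs D i us; rewrite -[togs _ _]/(hop_graph (x, y) D (a, b)) /=.
  by rewrite abD (negPf ayD) /= -[d i]DX /=; do !case: (_ == _); lia.
have := degY_togs D j us; rewrite -[togs _ _]/(hop_graph (x, y) D (a, b)) /=.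
by rewrite abD (negPf ayD) /= -[k j]DY /=; do !case: (_ == _); lia.
Qed.

Lemma helper_energy_ge0 q D : 0 <= H q D.
Proof. by apply: sumr_ge0 => e _; apply: addr_ge0; apply: switch_diff_ge0. Qed.

(* Two switches replace the helper of D by a common helper e, one switch moves the hole, and
   two switches replace e by the helper of the new graph. *)
Lemma filled_hop q D e' : D \in deficit d k q -> hop q D e' ->
  (g q D - g (hop_hole q e') (hop_graph q D e')) ^+ 2 <=
  5 * (H q D + H (hop_hole q e') (hop_graph q D e') + J q D e').
Proof.
move=> DO hD; have DO' := hop_deficit DO hD; case/andP: (hD) => e'D e'yD.
set q' := hop_hole q e'; set D' := hop_graph q D e'.
have hh := helperP dD kD Md DM D3 DO; have hh' := helperP dD kD Md DM D3 DO'.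
set h := helper q D in hh; set h' := helper q' D' in hh'.
(* Row q.1 and column q.2 make e a helper, column e'.2 keeps it one after the hop, and columns h.2
   and h'.2 make it compatible with both chosen helpers. *)
have [|e [eD hr hc]] := @far_edge_deficit _ _ _ _ _ _ dD kD Md DM D3 q D [:: q.1] [:: q.2; e'.2; h.2; h'.2] DO.
  by [].
have he : is_helper q D e by rewrite /is_helper eD hr ?hc ?inE ?eqxx.
have ee' : (e.1, e'.2) \notin D by rewrite hc // !inE eqxx orbT.
have che : compat D h e by rewrite /compat hc // !inE eqxx !orbT.
have [f1 f2 f3 he' sf] := switch_fill he e'D e'yD ee'.
have che' : compat D' h' e.
  rewrite /compat /D' /hop_graph !in_tog (negPf (hc _ _)) ?inE ?eqxx ?orbT //.
  have -> : (e.1, h'.2) == e' = false.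
    by apply/eqP => eq; rewrite -eq /= in ee'; rewrite eq e'D in ee'.
  rewrite xpair_eqE; have -> // : e.1 == e'.1 = false.
  by apply/eqP => eq; rewrite eq -surjective_pairing e'D in ee'.
have [_ _ s1] := switch_fill_mid hh he che.
have [_ _ _ s2] := switch_mid_fill hh he che.
have [_ _ s1'] := switch_fill_mid hh' he' che'.
have [_ _ _ s2'] := switch_mid_fill hh' he' che'.
have HD : F (fill q D h) (q.1, h.2) e + F (mid q D h e) (e.1, h.2) (h.1, q.2) <= H q D.
  apply: (ler_sum1 (F := fun e => F (fill q D h) (q.1, h.2) e + F (mid q D h e) (e.1, h.2) (h.1, q.2))).
    by rewrite /cand he.
  by move=> e2 _; apply: addr_ge0; apply: switch_diff_ge0.
have HD' : F (fill q' D' h') (q'.1, h'.2) e + F (mid q' D' h' e) (e.1, h'.2) (h'.1, q'.2) <= H q' D'.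
  apply: (ler_sum1 (F := fun e => F (fill q' D' h') (q'.1, h'.2) e + F (mid q' D' h' e) (e.1, h'.2) (h'.1, q'.2))).
    by rewrite /cand he'.
  by move=> e2 _; apply: addr_ge0; apply: switch_diff_ge0.
have JD : F (fill q D e) (e.1, q.2) e' <= J q D e'.
  apply: (ler_sum1 (F := fun e => F (fill q D e) (e.1, q.2) e')); first by rewrite he ee'.
  by move=> e2 _; apply: switch_diff_ge0.
move: HD HD' JD; rewrite /F s1 s2 s1' s2' sf => HD HD' JD.
rewrite /g -/h -/h'.
(* The five switches in order; the last two are traversed backwards, whence the minus signs. *)
rewrite (_ : f (fill q D h) - f (fill q' D' h') =
  (f (fill q D h) - f (mid q D h e)) + (f (mid q D h e) - f (fill q D e)) +
  (f (fill q D e) - f (fill q' D' e)) + - (f (mid q' D' h' e) - f (fill q' D' e)) +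
  - (f (fill q' D' h') - f (mid q' D' h' e))); last by ring.
apply: le_trans (sqr_sum5 _ _ _ _ _) _; rewrite !sqrrN.
by lra.
Qed.

Notation state := (E * {set E})%type.
Definition is_state (t : state) : bool := t.2 \in deficit d k t.1.

Lemma sum_state (Psi : E -> {set E} -> R) :
  \sum_q \sum_(D in deficit d k q) Psi q D = \sum_(t | is_state t) Psi t.1 t.2.
Proof. by rewrite pair_big_dep. Qed.

(** In both switches the two switched edges and the marker reveal q, h and e; undoing the toggles
    then gives D. The markers are (h.1, q.2) for the first switch and (q.1, e.2) for the second. *)
Lemma sum_helper_energy :
  \sum_(t | is_state t) H t.1 t.2 <= 2 * M%:R * energy.
Proof.
rewrite pair_big_dep /=.
have h1 : \sum_(p : state * E | is_state p.1 && cand p.1.1 p.1.2 p.2)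
    F (fill p.1.1 p.1.2 (helper p.1.1 p.1.2)) (p.1.1.1, (helper p.1.1 p.1.2).2) p.2 <= M%:R * energy.
  apply: (sum_switch_diff (c := fun p => ((helper p.1.1 p.1.2).1, p.1.1.2))) => [[[q D] e] /=|].
    case/andP=> DO /andP[he che]; have hh := helperP dD kD Md DM D3 DO.
    have [f1 f2 _] := switch_fill_mid hh he che; split=> //; first exact: fill_in DO hh.
    exact: fill_added.
  move=> [[q D] e] [[q' D'] e'] _ _ /= [eZ eq1 eh2 <- eh1 eq2].
  have eqq : q = q' by rewrite [q]surjective_pairing eq1 eq2 -surjective_pairing.
  have ehh : helper q D = helper q' D' by rewrite [LHS]surjective_pairing eh1 eh2 -surjective_pairing.
  by subst q'; rewrite /fill ehh in eZ; move/togs_inj: eZ => ->.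
have h2 : \sum_(p : state * E | is_state p.1 && cand p.1.1 p.1.2 p.2)
    F (mid p.1.1 p.1.2 (helper p.1.1 p.1.2) p.2) (p.2.1, (helper p.1.1 p.1.2).2)
      ((helper p.1.1 p.1.2).1, p.1.1.2) <= M%:R * energy.
  apply: (sum_switch_diff (c := fun p => (p.1.1.1, p.2.2))) => [[[q D] e] /=|].
    case/andP=> DO /andP[he che]; have hh := helperP dD kD Md DM D3 DO.
    have [f1 f2 f3 _] := switch_mid_fill hh he che; split=> //.
    have [g1 g2 <-] := switch_fill_mid hh he che.
    by rewrite switch_Bdk //; exact: fill_in DO hh.
  move=> [[q D] e] [[q' D'] e'] _ _ /= [eZ ee1 eh2 eh1 eq2 eq1 ee2].
  have eqq : q = q' by rewrite [q]surjective_pairing eq1 eq2 -surjective_pairing.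
  have eee : e = e' by rewrite [e]surjective_pairing ee1 ee2 -surjective_pairing.
  have ehh : helper q D = helper q' D' by rewrite [LHS]surjective_pairing eh1 eh2 -surjective_pairing.
  by subst q' e'; rewrite /mid /fill ehh in eZ; move/togs_inj/togs_inj: eZ => ->.
by rewrite big_split /= mulr2n mulrDl mul1r mulrDl; apply: lerD.
Qed.

Lemma sum_hop_energy :
  \sum_(p : state * E | is_state p.1 && hop p.1.1 p.1.2 p.2) J p.1.1 p.1.2 p.2 <= M%:R * energy.
Proof.
rewrite pair_big_dep /=.
apply: (sum_switch_diff (c := fun p => (p.1.1.1.1, p.2.2))) => [[[[q D] e'] e] /=|].
  case/andP=> /andP[DO /andP[e'D e'yD]] /andP[he ee'].
  have [f1 f2 f3 _ _] := switch_fill he e'D e'yD ee'; split=> //.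
  exact: fill_in DO he.
move=> [[[q D] e'] e] [[[p C] c'] c] _ _ /= [eZ ee1 eq2 <- eq1 ee2].
have eqq : q = p by rewrite [q]surjective_pairing eq1 eq2 -surjective_pairing.
have eee : e = c by rewrite [e]surjective_pairing ee1 ee2 -surjective_pairing.
by subst p c; rewrite /fill in eZ; move/togs_inj: eZ => ->.
Qed.

Definition flow_energy (q : E) (D : {set E}) : R :=
  (if q \in D then 0 else (g q D - f (tog D q)) ^+ 2) +
  \sum_(e | hop q D e) (g q D - g (hop_hole q e) (hop_graph q D e)) ^+ 2.

(** A state has fewer than M hops, so the helper energies at the starting states cost a factor M.
    Those at the end states reduce to the same bound by reversing the hop. *)
Lemma sum_hop_helper_energy :
  \sum_(p : state * E | is_state p.1 && hop p.1.1 p.1.2 p.2)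
    (H p.1.1 p.1.2 + H (hop_hole p.1.1 p.2) (hop_graph p.1.1 p.1.2 p.2)) <=
  4 * M%:R ^+ 2 * energy.
Proof.
have h1 : \sum_(p : state * E | is_state p.1 && (p.2 \in p.1.2)) H p.1.1 p.1.2 <= 2 * M%:R ^+ 2 * energy.
  rewrite -(pair_big_dep is_state (fun t e => e \in t.2) (fun t _ => H t.1 t.2)) /=.
  have -> : 2 * M%:R ^+ 2 * energy = M%:R * (2 * M%:R * energy) by ring.
  apply: le_trans (ler_wpM2l _ sum_helper_energy) => //.
  rewrite mulr_sumr; apply: ler_sum => -[q D] DO /=.
  rewrite sumr_const -[leLHS]mulr_natl ler_wpM2r ?helper_energy_ge0 // ler_nat.
  by rewrite -(card_deficit Md DO); apply: leqnSn.
have h0 : forall p : state * E, 0 <= H p.1.1 p.1.2 by move=> p; apply: helper_energy_ge0.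
rewrite big_split /= (_ : 4 * M%:R ^+ 2 * energy = 2 * M%:R ^+ 2 * energy + 2 * M%:R ^+ 2 * energy);
  last by ring.
apply: lerD; apply: le_trans h1.
  by apply: ler_sum_sub => // -[[q D] e] /andP[-> /andP[]].
(* The new state is recorded with the edge (e.1, q.2), along which the hole moves back. *)
apply: (@ler_sum_inj _ _ _ _ _ (fun p : state * E =>
  ((hop_hole p.1.1 p.2, hop_graph p.1.1 p.1.2 p.2), (p.2.1, p.1.1.2)))) => //.
  move=> [[q D] e] [[q' D'] e'] _ _ [eq1 ee2 eD ee1 eq2].
  have eqq : q = q' by rewrite [q]surjective_pairing eq1 eq2 -surjective_pairing.
  have eee : e = e' by rewrite [e]surjective_pairing ee1 ee2 -surjective_pairing.
  rewrite eqq eee; congr (_, _, _); move: eD; rewrite /hop_graph eqq eee.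
  by move/(congr1 (fun A => tog (tog A (e'.1, q'.2)) e')); rewrite !togK.
move=> [[q D] e] /= /andP[DO /[dup] hD /andP[eD eyD]].
rewrite /is_state /= hop_deficit //= /hop_graph !in_tog (negPf eyD) eqxx.
by rewrite addFb addbT; apply/negP => /eqP ee; rewrite ee eD in eyD.
Qed.

(** 26 = 1 + 5 (4 + 1): one switch at the ends of a path, and five times the helper and hop
    energies, with M <= M^2. *)
Lemma sum_flow_energy :
  \sum_q \sum_(D in deficit d k q) flow_energy q D <= (26 * M ^ 2)%:R * energy.
Proof.
rewrite sum_state big_split /=.
have E0 := energy_ge0.
have M1 : 1 <= M%:R :> R by rewrite ler1n; nia.
have h0 : \sum_(t | is_state t) (if t.1 \in t.2 then 0 else (g t.1 t.2 - f (tog t.2 t.1)) ^+ 2) <=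
    M%:R * energy.
  apply: (@le_trans _ _ (\sum_(t : state | is_state t && (t.1 \notin t.2))
     F (tog t.2 t.1) t.1 (helper t.1 t.2))).
    rewrite [leRHS]big_mkcondr /=; apply: ler_sum => -[q D] DO /=.
    case: ifP => //= /negbT qD; have hh := helperP dD kD Md DM D3 DO.
    have [_ _ sf] := switch_tog qD hh.
    by rewrite /F sf /g -sqrrN opprB.
  apply: (sum_switch_diff (c := fun t => t.1)) => [[q D] /= /andP[DO qD]|].
    have hh := helperP dD kD Md DM D3 DO.
    have [f1 f2 sf] := switch_tog qD hh; split=> //.
    by rewrite -(switch_Bdk d k f1 f2) sf; exact: fill_in DO hh.
  move=> [q D] [q' D'] _ _ /= [eD eq _ _]; rewrite eq in eD *.
  by move/(congr1 (fun A => tog A q')): eD; rewrite !togK => ->.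
have h1 : \sum_(t | is_state t) \sum_(e | hop t.1 t.2 e)
    (g t.1 t.2 - g (hop_hole t.1 e) (hop_graph t.1 t.2 e)) ^+ 2 <=
    5 * (4 * M%:R ^+ 2 * energy + M%:R * energy).
  rewrite pair_big_dep /=.
  apply: le_trans (ler_wpM2l _ (lerD sum_hop_helper_energy sum_hop_energy)) => //.
  rewrite -big_split /= mulr_sumr; apply: ler_sum => -[[q D] e] /= /andP[DO hD].
  exact: filled_hop.
have M2 : M%:R * energy <= M%:R ^+ 2 * energy.
  by rewrite ler_wpM2r // expr2 -[X in X <= _]mul1r ler_wpM2r.
by rewrite natrM natrX; lra.
Qed.

End Energy.

(** * The switch chain *)

Section Chain.
Variables (R : realType) (n m : nat) (d : 'I_n -> nat) (k : 'I_m -> nat).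
Variables (Delta M : nat).
Notation E := ('I_n * 'I_m)%type.
Notation Om := (Bdk d k).
Hypotheses (dD : forall i, (d i <= Delta)%N) (kD : forall j, (k j <= Delta)%N).
Hypotheses (d1 : forall i, (1 <= d i)%N) (k1 : forall j, (1 <= k j)%N).
Hypotheses (Md : M = (\sum_i d i)%N) (DM : (9 * Delta ^ 2 <= M)%N) (D3 : (3 <= Delta)%N).
Hypothesis Om0 : (0 < #|Om|)%N.

Let cardM := card_Bdk (k := k) Md.

Definition edge_pairs (C : {set E}) : {set E * E} := [set p | (p.1 \in C) && (p.2 \in C) && (p.1 != p.2)].

Definition switch_pairs (C B : {set E}) : {set E * E} :=
  [set p | (p.1 \in C) && (p.2 \in C) && (p.1 != p.2) && (switch C p.1 p.2 == B)].

(** The transition matrix Q of the chain without its lazy half, for graphs with M edges. *)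
Definition moves (C B : {set E}) : R := #|switch_pairs C B|%:R / (M * (M - 1))%:R.

Lemma moves_ge0 C B : 0 <= moves C B.
Proof. by rewrite mulr_ge0 // invr_ge0 ler0n. Qed.

Lemma switchPE C B : C \in Om -> switchP R C B = ((C == B)%:R + moves C B) / 2.
Proof.
move=> CO; rewrite /switchP cardM // /moves [RHS]mulrDl; congr (_ + _).
by rewrite invfM mulrA mulrAC.
Qed.

Lemma switch_pairs_Om C B p : C \in Om -> p \in switch_pairs C B -> B \in Om.
Proof.
move=> CO; rewrite inE => /andP[/andP[/andP[p1 p2] _] /eqP <-].
by rewrite switch_Bdk.
Qed.

Lemma moves_out C B : C \in Om -> B \notin Om -> moves C B = 0.
Proof.
move=> CO BO; rewrite /moves (_ : switch_pairs C B = set0) ?cards0 ?mul0r //.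
by apply/setP=> p; rewrite in_set0; apply/negP => /(switch_pairs_Om CO); apply/negP.
Qed.

Definition unswitch (p : E * E) : E * E := ((p.1.1, p.2.2), (p.2.1, p.1.2)).

Lemma unswitchK : involutive unswitch.
Proof. by case=> [[a b] [u v]]. Qed.

(** As C and B differ, the switch really takes place, and switching the two new edges undoes it. *)
Lemma card_switch_pairs_le C B : C != B -> (#|switch_pairs C B| <= #|switch_pairs B C|)%N.
Proof.
move=> CB; rewrite -(card_imset _ (inv_inj unswitchK)) subset_leq_card //.
apply/subsetP=> _ /imsetP[[[a b] [u v]] + ->]; rewrite !inE /=.
case/andP=> /andP[/andP[abC uvC] _] /eqP sw.
have [ok|/switch_out nok] := boolP (switch_ok C (a, b) (u, v)); last first.
  by move: CB; rewrite -sw nok eqxx.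
have BE := switchE abC uvC ok; rewrite sw in BE; case/and4P: ok => /= au bv avC ubC.
have ua : u == a = false by rewrite eq_sym (negPf au).
have vb : v == b = false by rewrite eq_sym (negPf bv).
have inB z : (z \in B) = (z \in C) (+) (z == (a, b)) (+) (z == (u, v)) (+) (z == (a, v)) (+) (z == (u, b)).
  by rewrite BE /togs /= !in_tog.
have avB : (a, v) \in B by rewrite inB !xpair_eqE (negPf avC) (negPf au) vb !eqxx.
have ubB : (u, b) \in B by rewrite inB !xpair_eqE (negPf ubC) ua (negPf bv) !eqxx.
rewrite avB ubB xpair_eqE (negPf au) /=; apply/eqP.
rewrite switchE //; last first.
  by apply/and4P; split; rewrite /= ?[_ == b]eq_sym // inB !xpair_eqE ?abC ?uvC
    ?(negPf au) ?(negPf bv) ?ua ?vb !eqxx.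
apply/setP=> z; rewrite /togs /= !in_tog inB.
by do !case: (_ == _); case: (_ \in _).
Qed.

Lemma movesC C B : moves C B = moves B C.
Proof.
rewrite /moves; have [->//|CB] := eqVneq C B.
congr (_%:R / _); apply/eqP; rewrite eqn_leq !card_switch_pairs_le //.
by rewrite eq_sym.
Qed.

Lemma sum_moves C (phi : {set E} -> R) : C \in Om ->
  \sum_(B in Om) moves C B * phi B =
  (\sum_(p in edge_pairs C) phi (switch C p.1 p.2)) / (M * (M - 1))%:R.
Proof.
move=> CO; rewrite [in RHS](partition_big (fun p => switch C p.1 p.2) [in Om]) /=; last first.
  by move=> p; rewrite inE => /andP[/andP[p1 p2] _]; rewrite switch_Bdk.
rewrite mulr_suml; apply: eq_bigr => B BO; rewrite /moves mulrAC; congr (_ / _).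
rewrite (eq_bigr (fun=> phi B)) => [|p /andP[_ /eqP->] //].
rewrite mulr_natl -sumr_const; apply: eq_bigl => p.
by rewrite !inE.
Qed.

Lemma card_edge_pairs C : C \in Om -> #|edge_pairs C| = (M * (M - 1))%N.
Proof.
move=> CO; rewrite -sum1_card.
rewrite (eq_bigl (fun p => (p.1 \in C) && (p.2 \in C :\ p.1))); last first.
  by move=> [e1 e2]; rewrite !inE /= [e2 == _]eq_sym -andbA; congr (_ && _); rewrite andbC.
rewrite -(pair_big_dep [in C] (fun e1 e2 => e2 \in C :\ e1) (fun _ _ => 1%N)) /=.
rewrite (eq_bigr (fun=> (M - 1)%N)) => [|e eC]; first by rewrite sum_nat_const cardM.
rewrite sum1_card; have := cardsD1 e C; rewrite eC cardM //.
by move=> ->; rewrite addKn.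
Qed.

Let N : R := (M * (M - 1))%:R.

Lemma N_gt0 : 0 < N.
Proof. by rewrite ltr0n; nia. Qed.

Lemma sum_moves1 C : C \in Om -> \sum_(B in Om) moves C B = 1.
Proof.
move=> CO; rewrite (eq_bigr (fun B => moves C B * 1)) => [|B _]; last by rewrite mulr1.
rewrite sum_moves // sumr_const card_edge_pairs // divff //.
by have := N_gt0; rewrite /N; case: ltgtP.
Qed.

Variable u : {set E} -> R.
Let Qu B := \sum_(C in Om) u C * moves C B.
Let S := \sum_(B in Om) u B ^+ 2.

(** Q is symmetric and stochastic, hence doubly stochastic, hence a contraction in the Euclidean
    norm. *)
Lemma sum_sqr_moves : \sum_(B in Om) Qu B ^+ 2 <= S.
Proof.
apply: (@le_trans _ _ (\sum_(B in Om) \sum_(C in Om) u C ^+ 2 * moves C B)).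
  apply: ler_sum => B BO.
  have -> : Qu B = \sum_C (if C \in Om then u C * moves C B else 0) by rewrite /Qu big_mkcond.
  pose w C := if C \in Om then moves C B else 0.
  apply: (le_trans (@sqr_sum_weighted _ _ w _ _ _)).
  - by move=> C; rewrite /w; case: ifP => // _; apply: moves_ge0.
  - by move=> C; rewrite /w; case: ifP => // _ ->; rewrite mulr0.
  rewrite {1}/w -big_mkcond /= (eq_bigr (fun C => moves B C)) => [|C _]; last exact: movesC.
  rewrite sum_moves1 // mul1r [leRHS]big_mkcond /=; apply: ler_sum => C _.
  rewrite /w; case: ifP => // _; last by rewrite expr0n mul0r.
  have [->|w0] := eqVneq (moves C B) 0; first by rewrite invr0 !mulr0.
  by rewrite exprMn expr2 [_ ^+ 2 as X in _ * X]expr2 mulrA mulfK.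
rewrite exchange_big /=; apply: ler_sum => C CO.
by rewrite -mulr_sumr sum_moves1 // mulr1.
Qed.

Lemma energy_moves : \sum_(C in Om) \sum_(B in Om) moves C B * (u C - u B) ^+ 2 = energy d k u / N.
Proof.
rewrite /energy mulr_suml; apply: eq_bigr => C CO.
rewrite (sum_moves (fun B => (u C - u B) ^+ 2)) //; congr (_ / _).
rewrite pair_big_dep /= [RHS](bigID (fun p => p.1 != p.2)) /= [X in _ = _ + X]big1 ?addr0.
  by apply: eq_bigl => p; rewrite inE.
move=> [e1 e2] /andP[_ /negPn/eqP /= <-].
by rewrite /switch_diff switch_out ?subrr ?expr0n // /switch_ok eqxx.
Qed.

(** The Dirichlet form of Q: expand (u C - u B)^2 and use that rows and columns of Q sum to 1. *)
Lemma energy_inner : energy d k u / N = 2 * (S - \sum_(B in Om) u B * Qu B).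
Proof.
rewrite -energy_moves.
have e1 : \sum_(C in Om) \sum_(B in Om) moves C B * u C ^+ 2 = S.
  by apply: eq_bigr => C CO; rewrite -mulr_suml sum_moves1 // mul1r.
have e2 : \sum_(C in Om) \sum_(B in Om) moves C B * u B ^+ 2 = S.
  rewrite exchange_big /=; apply: eq_bigr => C CO; rewrite -mulr_suml.
  by rewrite (eq_bigr (fun B => moves C B)) ?sum_moves1 ?mul1r // => B _; apply: movesC.
have e3 : \sum_(C in Om) \sum_(B in Om) moves C B * (u C * u B) = \sum_(B in Om) u B * Qu B.
  rewrite exchange_big /=; apply: eq_bigr => B BO; rewrite /Qu mulr_sumr.
  by apply: eq_bigr => C _; ring.
rewrite mulrBr mulr_natl mulr2n -{1}e1 -e2 -e3 mulr_sumr -big_split -sumrB /=.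
apply: eq_bigr => C CO; rewrite mulr_sumr -big_split -sumrB /=.
by apply: eq_bigr => B BO; ring.
Qed.

Hypothesis u0 : \sum_(B in Om) u B = 0.

Lemma poincare : S <= (52 * M ^ 5 * Delta.+1 ^ 2)%:R * energy d k u.
Proof.
pose g := filled u.
have Phi0 q D : 0 <= flow_energy u q D.
  rewrite /flow_energy addr_ge0 //; first by case: ifP => // _; apply: sqr_ge0.
  by apply: sumr_ge0 => e _; apply: sqr_ge0.
have := @flow_bound R n m d k (flow_energy u) Phi0 Delta (#|Om| * M ^ 2)%N dD kD
  (card_excess_le dD kD d1 k1 Md DM D3) M (fun B => cardM (B := B)) u g.
move=> /(_ _ _)/le_trans fb.
have {fb} : \sum_(A in Om) \sum_(B in Om) (u A - u B) ^+ 2 <=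
   (4 * M * (#|Om| * M ^ 2) * Delta.+1 ^ 2)%:R * ((26 * M ^ 2)%:R * energy d k u).
  apply: fb.
  - move=> q D DO qD; rewrite /flow_energy (negPf qD) lerDl.
    by apply: sumr_ge0 => e _; apply: sqr_ge0.
  - move=> q D e DO eD eqD; rewrite /flow_energy.
    apply: ler_wpDl; first by case: ifP => // _; apply: sqr_ge0.
    apply: (ler_sum1 (F := fun e => (filled u q D - filled u (hop_hole q e) (hop_graph q D e)) ^+ 2)).
      by rewrite /hop eD.
    by move=> e' _; apply: sqr_ge0.
  by apply: ler_wpM2l => //; apply: (sum_flow_energy dD kD Md DM D3).
(* As u has sum zero, the cross terms vanish. The factor |Bdk| then cancels against the one from
   [card_excess_le]. *)
have -> : \sum_(A in Om) \sum_(B in Om) (u A - u B) ^+ 2 = 2 * #|Om|%:R * S.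
  rewrite (eq_bigr (fun A => #|Om|%:R * u A ^+ 2 + S)); last first.
    move=> A AO; rewrite (eq_bigr (fun B => u A ^+ 2 + u B ^+ 2 - (2 * u A) * u B)) => [|B _]; last by ring.
    by rewrite sumrB big_split /= sumr_const -mulr_sumr u0 mulr0 subr0 mulr_natl.
  by rewrite big_split /= sumr_const -mulr_sumr -[S *+ _]mulr_natl -/S; ring.
have Om1 : 0 < #|Om|%:R :> R by rewrite ltr0n.
have -> : (4 * M * (#|Om| * M ^ 2) * Delta.+1 ^ 2)%:R * ((26 * M ^ 2)%:R * energy d k u) =
  2 * #|Om|%:R * ((52 * M ^ 5 * Delta.+1 ^ 2)%:R * energy d k u).
  by rewrite !(natrM, natrX); ring.
by rewrite ler_pM2l // mulr_gt0.
Qed.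

(* 4 and 26 come from [flow_bound] and [sum_flow_energy]; the variance brings 1/2, and
   the conversion of [energy] into the Dirichlet form of the lazy chain 4 M (M - 1). *)
Definition relax : R := (208 * M ^ 7 * Delta.+1 ^ 2)%:R.

Lemma relax_gt0 : 0 < relax.
Proof.
have M0 : (0 < M)%N by nia.
by rewrite ltr0n muln_gt0 [(0 < 208 * _)%N]muln_gt0 !expn_gt0 M0.
Qed.

(* Writing P = (1 + Q) / 2, the contraction property of Q gives |P u|^2 <= <u, P u>. *)
Lemma contraction :
  \sum_(B in Om) (\sum_(C in Om) u C * switchP R C B) ^+ 2 <= (1 - relax^-1) * S.
Proof.
have step1 B : B \in Om -> \sum_(C in Om) u C * switchP R C B = (u B + Qu B) / 2.
  move=> BO; rewrite (eq_bigr (fun C => (u C * (C == B)%:R + u C * moves C B) / 2)); last first.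
    by move=> C CO; rewrite switchPE // mulrA mulrDr.
  rewrite -mulr_suml big_split /= (bigD1 B) //= eqxx mulr1 big1 ?addr0 // => C /andP[_ /negPf->].
  by rewrite mulr0.
rewrite (eq_bigr (fun B => (u B + Qu B) ^+ 2 / 4)); last first.
  by move=> B BO; rewrite step1 //; field.
have eN := energy_inner; have qs := sum_sqr_moves; have po := poincare.
have -> : \sum_(B in Om) (u B + Qu B) ^+ 2 / 4 =
   (S + 2 * (\sum_(B in Om) u B * Qu B) + \sum_(B in Om) Qu B ^+ 2) / 4.
  rewrite /S mulr_sumr -!big_split /= -mulr_suml; congr (_ / _).
  by apply: eq_bigr => B _; ring.
(* Uses relax = 4 M^2 times the constant of [poincare], and M (M - 1) <= M^2. *)
have key : relax^-1 * S <= energy d k u / N / 4.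
  rewrite ler_pdivrMl ?relax_gt0 //; apply: (le_trans po).
  have E0 := energy_ge0 d k u.
  have -> : relax * (energy d k u / N / 4) = (relax / N / 4) * energy d k u by ring.
  apply: ler_wpM2r => //; rewrite ler_pdivlMr // ler_pdivlMr ?N_gt0 // /N /relax -!natrM ler_nat.
  have -> : (208 * M ^ 7 * Delta.+1 ^ 2 = 52 * M ^ 5 * Delta.+1 ^ 2 * 4 * (M * M))%N by ring.
  by rewrite leq_mul2l leq_mul2l leq_subr !orbT.
rewrite mulrBl mul1r; move: key qs; rewrite eN.
move: (relax^-1 * S) (\sum_(B in Om) u B * Qu B) (\sum_(B in Om) Qu B ^+ 2) => x y z.
by move: S => s; lra.
Qed.

End Chain.

Lemma leq_bin_exp N r : ('C(N, r) <= N ^ r)%N.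
Proof.
apply: (@leq_trans (N ^_ r)); first by rewrite -bin_ffact leq_pmulr // fact_gt0.
rewrite ffact_prod -[X in (_ <= _ ^ X)%N]card_ord -prod_nat_const.
by apply: leq_prod => i _; apply: leq_subr.
Qed.

(** * From the contraction to the mixing time *)

Section Mixing.
Variables (R : realType) (n m : nat) (d : 'I_n -> nat) (k : 'I_m -> nat).
Variables (Delta M : nat).
Notation E := ('I_n * 'I_m)%type.
Notation Om := (Bdk d k).
Hypotheses (dD : forall i, (d i <= Delta)%N) (kD : forall j, (k j <= Delta)%N).
Hypotheses (d1 : forall i, (1 <= d i)%N) (k1 : forall j, (1 <= k j)%N).
Hypotheses (Md : M = (\sum_i d i)%N) (Mk : M = (\sum_j k j)%N).
Hypotheses (DM : (9 * Delta ^ 2 <= M)%N) (D3 : (3 <= Delta)%N).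

(** All degrees being positive, n and m are at most M, so a graph is one of at most (M^2)^M choices
    of M edges. *)
Lemma card_Bdk_le : (#|Om| <= M ^ (2 * M))%N.
Proof.
apply: (@leq_trans #|[set A : {set E} | #|A| == M]|).
  apply: subset_leq_card; apply/subsetP=> B BO.
  by rewrite inE (card_Bdk Md BO).
rewrite card_draws; apply: leq_trans (leq_bin_exp _ _) _.
rewrite expnM leq_exp2r; last by nia.
rewrite card_prod !card_ord -mulnn leq_mul //.
  by rewrite Md -[n in (n <= _)%N]card_ord -sum1_card leq_sum.
by rewrite Mk -[m in (m <= _)%N]card_ord -sum1_card leq_sum.
Qed.

Variable B0 : {set E}.
Hypothesis B0O : B0 \in Om.

Let Om0 : (0 < #|Om|)%N. Proof. by apply/card_gt0P; exists B0. Qed.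

Lemma switchPt_out t B : B \notin Om -> switchPt R t B0 B = 0.
Proof.
elim: t B => [|t IH] B BO /=.
  by case: eqVneq => // eq; rewrite -eq B0O in BO.
apply: big1 => C _; have [CO|CO] := boolP (C \in Om); last by rewrite IH // mul0r.
rewrite (switchPE R Md _ CO) (moves_out _ _ CO BO) addr0 (_ : C == B = false) ?mul0r ?mulr0 //.
by apply/eqP=> eq; rewrite -eq CO in BO.
Qed.

Lemma switchPtS t B : switchPt R t.+1 B0 B = \sum_(C in Om) switchPt R t B0 C * switchP R C B.
Proof.
rewrite /= [RHS]big_mkcond; apply: eq_bigr => C _.
by case: ifP => // /negbT /switchPt_out->; rewrite mul0r.
Qed.

Lemma sum_switchPl B : B \in Om -> \sum_(C in Om) switchP R C B = 1.
Proof.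
move=> BO; rewrite (eq_bigr (fun C => ((C == B)%:R + moves R M B C) / 2)); last first.
  by move=> C CO; rewrite (switchPE R Md _ CO) movesC.
rewrite -mulr_suml big_split /= (sum_moves1 R Md DM D3 Om0) // (bigD1 B) //= eqxx big1 ?addr0.
  by rewrite [true%:R]mulr1n; lra.
by move=> C /andP[_ /negPf->].
Qed.

Lemma sum_switchPr C : C \in Om -> \sum_(B in Om) switchP R C B = 1.
Proof.
move=> CO; rewrite (eq_bigr (fun B => ((B == C)%:R + moves R M C B) / 2)); last first.
  by move=> B BO; rewrite (switchPE R Md _ CO) eq_sym.
rewrite -mulr_suml big_split /= (sum_moves1 R Md DM D3 Om0) // (bigD1 C) //= eqxx big1 ?addr0.
  by rewrite [true%:R]mulr1n; lra.
by move=> B /andP[_ /negPf->].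
Qed.

Lemma sum_switchPt t : \sum_(B in Om) switchPt R t B0 B = 1.
Proof.
elim: t => [|t IH].
  rewrite (bigD1 B0) //= eqxx big1 ?addr0 // => B /andP[_].
  by rewrite eq_sym => /negPf->.
rewrite (eq_bigr _ (fun B _ => switchPtS t B)) exchange_big /= -[RHS]IH.
by apply: eq_bigr => C CO; rewrite -mulr_sumr sum_switchPr // mulr1.
Qed.

Definition bias t B : R := switchPt R t B0 B - #|Om|%:R^-1.

Lemma sum_bias t : \sum_(B in Om) bias t B = 0.
Proof.
rewrite sumrB sum_switchPt sumr_const -[_ *+ _]mulr_natl divff ?subrr //.
by rewrite pnatr_eq0 -lt0n.
Qed.

Lemma biasS t B : B \in Om -> bias t.+1 B = \sum_(C in Om) bias t C * switchP R C B.
Proof.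
move=> BO; rewrite (eq_bigr (fun C => switchPt R t B0 C * switchP R C B - #|Om|%:R^-1 * switchP R C B)).
  by rewrite sumrB -switchPtS -mulr_sumr sum_switchPl // mulr1.
by move=> C _; rewrite mulrBl.
Qed.

Notation K0 := (relax R Delta M).

Lemma relax_ge1 : 1 <= K0.
Proof. by have := relax_gt0 R Md DM D3 Om0; rewrite /relax ltr0n ler1n. Qed.

(** Initially the squared norm is 1 - 1/|Bdk|; every step contracts it, since the bias has sum
    zero. *)
Lemma sum_sqr_bias t : \sum_(B in Om) bias t B ^+ 2 <= (1 - K0^-1) ^+ t.
Proof.
elim: t => [|t IH].
  rewrite expr0 (eq_bigr (fun B => (B == B0)%:R * (1 - 2 * #|Om|%:R^-1) + #|Om|%:R^-1 ^+ 2)).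
    rewrite big_split /= -mulr_suml (bigD1 B0) //= eqxx big1 ?addr0 => [|B /andP[_ /negPf->]//].
    rewrite [true%:R]mulr1n mul1r sumr_const -[X in _ + X <= _]mulr_natl expr2 mulrA divff ?pnatr_eq0 -?lt0n //.
    have : 0 <= #|Om|%:R^-1 :> R by rewrite invr_ge0.
    by lra.
  move=> B _; rewrite /bias /= eq_sym; case: (B == B0) => /=; ring.
rewrite (eq_bigr _ (fun B BO => congr1 (fun x => x ^+ 2) (biasS t BO))).
apply: (le_trans (contraction dD kD d1 k1 Md DM D3 Om0 (sum_bias t))).
rewrite exprS ler_wpM2l // subr_ge0 invf_le1 ?relax_ge1 //.
exact: lt_le_trans relax_ge1.
Qed.

(** Cauchy-Schwarz on Bdk, outside of which both distributions vanish. *)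
Lemma dTV_sqr_le t : (2 * dTV R d k t B0) ^+ 2 <= #|Om|%:R * (1 - K0^-1) ^+ t.
Proof.
have -> : 2 * dTV R d k t B0 = \sum_(B : {set E}) (if B \in Om then `|bias t B| else 0).
  rewrite /dTV mulrA divff ?mul1r ?pnatr_eq0 //; apply: eq_bigr => B _.
  case: ifP => BO; rewrite /unifBdk /bias.
    by move: BO; rewrite inE => ->.
  by move: (BO); rewrite inE => ->; rewrite switchPt_out ?BO // subr0 normr0.
pose w B : R := if B \in Om then 1 else 0.
apply: (le_trans (@sqr_sum_weighted _ _ w _ _ _)).
- by move=> B; rewrite /w; case: ifP.
- by move=> B; rewrite /w; case: ifP => // _ /eqP; rewrite oner_eq0.
have -> : \sum_B w B = #|Om|%:R by rewrite /w -big_mkcond sumr_const.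
apply: ler_wpM2l => //; apply: le_trans (sum_sqr_bias t).
rewrite [leRHS]big_mkcond; apply: ler_sum => B _; rewrite /w.
by case: ifP => _; rewrite ?divr1 ?real_normK ?num_real // expr0n mul0r.
Qed.

(** With |Bdk| <= M^(2M) and 1 - x <= exp(-x), the hypothesis on t says that the bound of
    [dTV_sqr_le] is at most eps^2. *)
Lemma dTV_le (eps : R) t : 0 < eps ->
  2 * M%:R * ln (M%:R : R) + 2 * ln eps^-1 <= t%:R / K0 -> dTV R d k t B0 <= eps.
Proof.
move=> eps0 ht; have M0 : 0 < M%:R :> R by rewrite ltr0n; nia.
have K00 : 0 < K0 := lt_le_trans ltr01 relax_ge1.
have bound : (2 * dTV R d k t B0) ^+ 2 <= eps ^+ 2.
  apply: (le_trans (dTV_sqr_le t)).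
  have h1 : #|Om|%:R <= expR (2 * M%:R * ln (M%:R : R)).
    rewrite -natrM expRM_natl lnK ?posrE // -natrX ler_nat.
    exact: card_Bdk_le.
  have h2 : (1 - K0^-1) ^+ t <= expR (- (t%:R / K0)).
    rewrite -mulrN expRM_natl lerXn2r ?nnegrE ?expR_ge0 ?expR_ge1Dx //.
    by rewrite subr_ge0 invf_le1 ?relax_ge1.
  have h3 : eps ^+ 2 = expR (- (2 * ln eps^-1)).
    rewrite lnV ?posrE // mulrN opprK expRM_natl lnK ?posrE //.
  apply: (@le_trans _ _ (expR (2 * M%:R * ln (M%:R : R)) * expR (- (t%:R / K0)))).
    apply: ler_pM => //; apply: exprn_ge0.
    by rewrite subr_ge0 invf_le1 ?relax_ge1.
  by rewrite -expRD h3 ler_expR lerBlDr [leRHS]addrC -lerBlDr opprK.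
have d0 : 0 <= dTV R d k t B0.
  by rewrite mulr_ge0 ?invr_ge0 //; apply: sumr_ge0.
have : 2 * dTV R d k t B0 <= eps.
  by rewrite -(@ler_pXn2r _ 2) // nnegrE; [exact: mulr_ge0|exact: ltW].
by apply: le_trans; rewrite ler_peMl // ler1n.
Qed.

Lemma ln_ge_half : 1 / 2 <= ln (M%:R : R).
Proof.
have M2 : 2 <= M%:R :> R by rewrite ler_nat; nia.
have M0 : 0 < M%:R :> R by lra.
have := expR_ge1Dx (- ln (M%:R : R)).
rewrite expRN lnK ?posrE // => h.
have : M%:R^-1 <= 2^-1 :> R by rewrite lef_pV2 ?posrE.
by lra.
Qed.

Lemma mixing_bound (eps : R) : 0 < eps < 1 ->
  exists T : nat, T%:R <= (Delta ^ 10 * M ^ 7)%:R * (2^-1 * M%:R * ln (M%:R : R) + ln eps^-1) /\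
    forall t : nat, (T <= t)%N -> dTV R d k t B0 <= eps.
Proof.
case/andP=> eps0 eps1; set X := _ + ln eps^-1; set K := _%:R.
have le0 : 0 < ln eps^-1 by rewrite lnV ?posrE // oppr_gt0 ln_lt0 // eps0.
have M4 : 4 <= M%:R :> R by rewrite ler_nat; nia.
have lM := ln_ge_half.
have X1 : 1 <= X.
  have : 4 * (1 / 2) <= M%:R * ln (M%:R : R) by apply: ler_pM => //; lra.
  by rewrite /X -mulrA; lra.
have K00 : 0 < K0 := lt_le_trans ltr01 relax_ge1.
(* 5 times 208 is 1040, (Delta + 1)^2 <= 2 Delta^2, and 2080 <= 3^8 <= Delta^8. *)
have KK : 5 * K0 <= K.
  rewrite /K /relax -natrM ler_nat.
  have -> : (5 * (208 * M ^ 7 * Delta.+1 ^ 2) = 1040 * Delta.+1 ^ 2 * M ^ 7)%N by ring.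
  rewrite leq_mul2r; apply/orP; right.
  have -> : (Delta ^ 10 = Delta ^ 8 * Delta ^ 2)%N by rewrite -expnD.
  have h8 : (3 ^ 8 <= Delta ^ 8)%N by rewrite leq_exp2r.
  have h2 : (Delta.+1 ^ 2 <= 2 * Delta ^ 2)%N by nia.
  apply: (@leq_trans (1040 * (2 * Delta ^ 2))); first by rewrite leq_mul2l h2.
  by rewrite mulnA leq_mul2r (leq_trans _ h8) ?orbT.
have KX0 : 0 <= K * X by rewrite mulr_ge0 //; lra.
exists (Num.truncn (K * X)); have /andP[t1 t2] := truncn_itv KX0; split=> // t Tt.
apply: dTV_le => //; rewrite ler_pdivlMr //.
(* Rounding down loses at most 1, which is at most K0 X. So 5 K0 X <= t + 1 leaves t >= 4 K0 X, more
   than [dTV_le] needs. *)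
have tK : K * X <= t%:R + 1.
  by apply: (le_trans (ltW t2)); rewrite -natr1 lerD2r ler_nat.
have : 5 * K0 * X <= K * X by apply: ler_wpM2r => //; lra.
have : 1 * 1 <= K0 * X by apply: ler_pM => //; apply: relax_ge1.
have : K0 * ln eps^-1 >= 0 by rewrite mulr_ge0 // ltW.
rewrite (_ : (2 * M%:R * ln (M%:R : R) + 2 * ln eps^-1) * K0 = 4 * (K0 * X) - 2 * (K0 * ln eps^-1)).
  by rewrite -[5 * K0 * X]mulrA; lra.
by rewrite /X; field.
Qed.

End Mixing.

Theorem theoremA2 (R : realType) (n m : nat) (d : 'I_n -> nat) (k : 'I_m -> nat)
  (eps : R) :
  (\sum_(i < n) d i = \sum_(j < m) k j)%N ->
  (forall i, (1 <= d i)%N) -> (forall j, (1 <= k j)%N) ->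
  let M := (\sum_(i < n) d i)%N in
  let dmax := (\max_(i < n) d i)%N in
  let kmax := (\max_(j < m) k j)%N in
  let Delta := maxn dmax kmax in
  (3 <= dmax)%N -> (3 <= kmax)%N ->
  dmax%:R <= Num.sqrt (M%:R : R) / 3 -> kmax%:R <= Num.sqrt (M%:R : R) / 3 ->
  0 < eps < 1 ->
  @mixing_time_le R n m d k eps
    ((Delta ^ 10 * M ^ 7)%:R * (2^-1 * M%:R * ln (M%:R : R) + ln eps^-1)).
Proof.
move=> dk d1 k1 M dmax kmax Delta d3 k3 dM kM heps B0 B0O.
(* The sparsity hypothesis, squared, becomes an inequality between natural numbers. *)
have sq a : a%:R <= Num.sqrt (M%:R : R) / 3 -> (9 * a ^ 2 <= M)%N.
  move=> h; rewrite -(ler_nat R) natrM natrX -[leRHS](sqr_sqrtr (ler0n R M)).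
  have s0 := sqrtr_ge0 (M%:R : R); have a0 := ler0n R a.
  have : 3 * a%:R <= Num.sqrt (M%:R : R) by lra.
  move=> h3; have -> : 9%:R * a%:R ^+ 2 = (3 * a%:R) ^+ 2 :> R by ring.
  by rewrite lerXn2r ?nnegrE // mulr_ge0.
apply: (@mixing_bound R n m d k Delta M) => //.
- by move=> i; apply: leq_trans (leq_maxl _ _); apply: leq_bigmax.
- by move=> j; apply: leq_trans (leq_maxr _ _); apply: leq_bigmax.
- by rewrite /Delta /maxn; case: ifP => _; apply: sq.
by apply: leq_trans d3 (leq_maxl _ _).
Qed.
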